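(* Let $r$ and $n$ be positive integers. Then: $$\mathcal{F}_1\left(K_{1,n}\circ K_r\right)\simeq\bigvee_{\binom{r-1}{2}^n}\mathbb{S}^{2n-1}\vee\bigvee_{(nr^2-1)+\binom{r-1}{2}}\mathbb{S}^1;$$ for $2\leq d\leq n-1$, $$\mathcal{F}_d\left(K_{1,n}\circ K_r\right)\simeq\bigvee_{\binom{r-1}{2}^n}\mathbb{S}^{2n-1}\vee\bigvee_{r f_{d-1}(r,n-1)}\mathbb{S}^d\vee\bigvee_{\binom{r}{2}}\mathbb{S}^1,$$ where $f_{d-1}(r,n-1)=\sum_{i=0}^{d}(-1)^{d-i}\binom{n}{i}r^i$; and for $d=\infty$, $$\mathcal{F}_\infty\left(K_{1,n}\circ K_r\right)\simeq\bigvee_{\binom{r-1}{2}^n}\mathbb{S}^{2n-1}\vee\bigvee_{r(r-1)^n}\mathbb{S}^n\vee\bigvee_{\binom{r}{2}}\mathbb{S}^1.$$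
   Context: Graphs are finite and simple. For a graph $G$ and an integer $d\ge 0$, $\mathcal{F}_d(G)$ is the simplicial complex of all $\sigma\subseteq V(G)$ such that the induced subgraph $G[\sigma]$ is a forest with maximum degree at most $d$; $\mathcal{F}_\infty(G)$ is the complex of all $\sigma\subseteq V(G)$ such that $G[\sigma]$ is a forest. Complexes are identified with their geometric realizations. The lexicographic product $G\circ H$ has vertex set $V(G)\times V(H)$ and edges $\{(u,v_1),(u,v_2)\}$ for $\{v_1,v_2\}\in E(H)$ and $\{(u_1,v_1),(u_2,v_2)\}$ for $\{u_1,u_2\}\in E(G)$. $K_{1,n}$ is the star with $n$ leaves and $K_r$ the complete graph on $r$ vertices. $\bigvee_m Y$ is the wedge of $m$ copies of $Y$ (a point if $m=0$). *)

(* Defs.v *)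
From HB Require Import structures.
From mathcomp Require Import all_boot all_order all_algebra.
From mathcomp Require Import all_classical all_reals all_analysis.
From mathcomp Require Import homotopy ring lra zify.

Set Implicit Arguments.
Unset Strict Implicit.
Unset Printing Implicit Defensive.

Import Order.TTheory GRing.Theory Num.Theory.
Import numFieldNormedType.Exports.

Local Open Scope classical_set_scope.
Local Open Scope ring_scope.

Record sgraph := SGraph {
  vertex :> finType;
  edge : rel vertex;
  edge_sym : symmetric edge;
  edge_irr : irreflexive edge
}.

Section GraphNotions.
Local Open Scope nat_scope.
Implicit Type G : sgraph.

Definition is_forest G : Prop :=
  forall c : seq G, 2 < size c -> ~ ucycle (@edge G) c.

Definition degree G (v : G) : nat := #|[pred w | edge v w]|.

Definition max_degree G : nat := \max_(v : G) degree v.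

Section Induced.
Variables (G : sgraph) (s : {set G}).

Definition induced_vertex : finType := {v : G | v \in s}.
Definition induced_edge : rel induced_vertex :=
  fun v w => edge (val v) (val w).

Lemma induced_edge_sym : symmetric induced_edge.
Proof. by move=> v w; exact: edge_sym. Qed.

Lemma induced_edge_irr : irreflexive induced_edge.
Proof. by move=> v; exact: edge_irr. Qed.

Definition induced := SGraph induced_edge_sym induced_edge_irr.
End Induced.

Section Lexicographic.
Variables G H : sgraph.

Definition lex_edge : rel (G * H)%type := fun p q =>
  ((p.1 == q.1) && edge p.2 q.2) || edge p.1 q.1.

Lemma lex_edge_sym : symmetric lex_edge.
Proof.
by move=> p q; rewrite /lex_edge eq_sym (edge_sym p.2) (edge_sym p.1).
Qed.

Lemma lex_edge_irr : irreflexive lex_edge.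
Proof. by move=> p; rewrite /lex_edge !edge_irr andbF. Qed.

Definition lex_product := SGraph lex_edge_sym lex_edge_irr.
End Lexicographic.

Section Star.
Variable n : nat.

(* The centre is [None], the leaves are the [Some i]. *)
Definition star_edge : rel (option 'I_n) := fun v w => isSome v (+) isSome w.

Lemma star_edge_sym : symmetric star_edge.
Proof. by move=> v w; rewrite /star_edge addbC. Qed.

Lemma star_edge_irr : irreflexive star_edge.
Proof. by move=> v; rewrite /star_edge addbb. Qed.

Definition star := SGraph star_edge_sym star_edge_irr.
End Star.

Section Complete.
Variable r : nat.

Definition complete_edge : rel 'I_r := fun v w => v != w.

Lemma complete_edge_sym : symmetric complete_edge.
Proof. by move=> v w; rewrite /complete_edge eq_sym. Qed.

Lemma complete_edge_irr : irreflexive complete_edge.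
Proof. by move=> v; rewrite /complete_edge eqxx. Qed.

Definition complete := SGraph complete_edge_sym complete_edge_irr.
End Complete.

End GraphNotions.

(* The empty simplex is allowed; it contributes no point to the realization. *)
Record scomplex (V : finType) := SComplex {
  simplices : set {set V};
  simplices_down : forall s t : {set V},
    t \subset s -> simplices s -> simplices t
}.

Section ForestComplexes.
Local Open Scope nat_scope.
Variable G : sgraph.

Section Monotone.
Variables (s t : {set G}) (ts : t \subset s).

Let emb (v : induced t) : induced s :=
  exist _ (val v) (fintype.subsetP ts _ (valP v)).

Let emb_inj : injective emb.
Proof. by move=> v w /(congr1 val) /= /val_inj. Qed.

Lemma induced_forest_sub : is_forest (induced s) -> is_forest (induced t).
Proof.
move=> fs c c2 /andP[cc uc]; apply: (fs (map emb c)); rewrite ?size_map //.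
by apply/andP; split; [rewrite cycle_map | rewrite map_inj_uniq].
Qed.

Lemma max_degree_induced_sub : max_degree (induced t) <= max_degree (induced s).
Proof.
apply/bigmax_leqP => v _; apply: leq_trans (leq_bigmax (emb v)).
rewrite /degree -(fintype.card_image emb_inj).
apply/subset_leq_card/fintype.subsetP => w.
by move=> /fintype.imageP[u]; rewrite !inE => uv ->.
Qed.
End Monotone.

Definition forest_simplices : set {set G} :=
  fun s => is_forest (induced s).

Definition bounded_forest_simplices (d : nat) : set {set G} :=
  fun s => is_forest (induced s) /\ max_degree (induced s) <= d.

Lemma forest_simplices_down (s t : {set G}) : t \subset s ->
  forest_simplices s -> forest_simplices t.
Proof. exact: induced_forest_sub. Qed.

Lemma bounded_forest_simplices_down (d : nat) (s t : {set G}) : t \subset s ->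
  bounded_forest_simplices d s -> bounded_forest_simplices d t.
Proof.
move=> ts [fs ds]; split; first exact: induced_forest_sub fs.
exact: leq_trans (max_degree_induced_sub ts) ds.
Qed.
End ForestComplexes.

(* [forest_complex G] is F_oo(G), [bounded_forest_complex d G] is F_d(G). *)
Definition forest_complex (G : sgraph) : scomplex G :=
  SComplex (@forest_simplices_down G).

Definition bounded_forest_complex (d : nat) (G : sgraph) : scomplex G :=
  SComplex (@bounded_forest_simplices_down G d).

Section Realization.
Variables (R : realType) (V : finType) (K : scomplex V).

(* Barycentric coordinates, with the topology induced from R^V. *)
Definition realization_set : set (prod_topology (fun _ : V => R)) :=
  [set x | [/\ forall v, 0 <= x v, \sum_(v : V) x v = 1
             & simplices K [set v | x v != 0]%SET]].

Definition realization : topologicalType := set_type realization_set.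
End Realization.

Section Homotopy.
Variable R : realType.

Definition homotopic (X Y : topologicalType) (f g : X -> Y) : Prop :=
  exists2 H : X * R -> Y,
    {within [set: X] `*` `[0, 1], continuous H} &
    forall x, H (x, 0) = f x /\ H (x, 1) = g x.

Definition homotopy_equivalent (X Y : topologicalType) : Prop :=
  exists (f : X -> Y) (g : Y -> X),
    [/\ continuous f, continuous g,
        homotopic (g \o f) idfun & homotopic (f \o g) idfun].
End Homotopy.

Section Sphere.
Variables (R : realType) (k : nat).

Definition sphere_set : set 'rV[R]_k.+1 :=
  [set x | \sum_(i < k.+1) x 0 i ^+ 2 = 1].

Lemma sphere_base_subproof : delta_mx 0 0 \in sphere_set.
Proof.
apply/mem_set; rewrite /sphere_set /= (bigD1 0) //= big1 => [|i /negPf i0].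
  by rewrite !mxE !eqxx expr1n addr0.
by rewrite !mxE i0 andbF expr0n.
Qed.

Definition sphere : Type := set_type sphere_set.

HB.instance Definition _ := Topological.on sphere.
HB.instance Definition _ := isPointed.Build sphere
  (exist _ (delta_mx 0 0) sphere_base_subproof).
End Sphere.

Definition one_point : Type := unit.

HB.instance Definition _ := Pointed.copy one_point unit.
HB.instance Definition _ := Topological.copy one_point (discrete_topology unit).

(* One summand is a one-point space, so that the wedge of no copies of [Y] is
   a point; with at least one copy it does not change the space. *)
Definition wedge_copies (m : nat) (Y : ptopologicalType) : ptopologicalType :=
  pwedge (fun i : option 'I_m =>
    if i is Some _ then Y else one_point).

Definition wedge2 (Y Z : ptopologicalType) : ptopologicalType :=
  pwedge (fun b : bool => if b then Y else Z).

Definition wedge_spheres (R : realType) (m k : nat) : ptopologicalType :=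
  wedge_copies m (sphere R k).

(* [skeleton_rank d r n] is f_{d-1}(r, n-1). *)
Definition skeleton_rank (d r n : nat) : int :=
  \sum_(i < d.+1) (-1) ^+ (d - i) * ('C(n, i) * r ^ i)%N%:Z.

Lemma skeleton_rankS (d r n : nat) :
  skeleton_rank d.+1 r n.+1 =
    skeleton_rank d.+1 r n + r%:Z * skeleton_rank d r n.
Proof.
rewrite /skeleton_rank big_ord_recl [in RHS]big_ord_recl /= !bin0 -addrA.
congr (_ + _); rewrite mulr_sumr -big_split /=; apply: eq_bigr => i _.
rewrite /bump /= !add1n subSS binS mulnDl PoszD mulrDr; congr (_ + _).
by rewrite expnS mulnCA PoszM mulrCA.
Qed.

Lemma skeleton_rank_diag (r n : nat) :
  skeleton_rank n r n = (r%:Z - 1) ^+ n.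
Proof.
rewrite addrC exprDn; apply: eq_bigr => i _.
by rewrite -mulr_natl mulrCA PoszM natz -[(r ^ i)%N%:Z]natz natrX natz.
Qed.

(* Hence reading a multiplicity off with [absz] loses nothing. *)
Lemma skeleton_rank_ge0 (d r n : nat) :
  (0 < r)%N -> (d <= n)%N -> 0 <= skeleton_rank d r n.
Proof.
move=> r0; elim: n d => [|n IHn] d dn.
  move: dn; rewrite leqn0 => /eqP ->.
  by rewrite skeleton_rank_diag expr0.
have [->|dn1] := eqVneq d n.+1.
  by rewrite skeleton_rank_diag exprn_ge0// subr_ge0.
have {dn1}dn : (d <= n)%N by lia.
case: d dn => [_|d dn].
  by rewrite /skeleton_rank big_ord1 /= bin0 expr0 mul1r.
by rewrite skeleton_rankS addr_ge0 ?mulr_ge0 ?IHn//; lia.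
Qed.

(* Main.v *)
Require Import Defs.
From mathcomp Require Import all_boot all_order all_algebra.
From mathcomp Require Import all_classical all_reals all_analysis.
From mathcomp Require Import homotopy ring lra zify.

Set Implicit Arguments.
Unset Strict Implicit.
Unset Printing Implicit Defensive.

Import Order.TTheory GRing.Theory Num.Theory.
Import numFieldNormedType.Exports.

Local Open Scope classical_set_scope.
Local Open Scope ring_scope.

(** The complex F_d of the star of cliques is, for every d >= 1 (take d = n for
    the forest complex), a set of faces with an explicit description.  A vertex
    set s without triangle has at most two vertices in the union of the central
    clique and any one leaf clique, and such a set has at most one vertex of
    degree larger than 1, a unique central vertex, whose degree is #|s| - 1.
    So s is a face exactly when these clique bounds hold and, if s has exactly
    one central vertex, #|s| <= d + 1 ([bounded_forest_faces],
    [forest_faces]).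

    Matching faces that differ by the vertex 0 of a suitable leaf clique (the
    first one where this vertex can be added without breaking the clique bound)
    pairs off all faces but some [critical] ones, and it pairs the empty face
    with a vertex v0.  The matching is acyclic and the critical faces are
    maximal, so the matched faces form a subcomplex L that collapses to v0
    ([deform_matched]), and the whole complex is L with some cells glued along
    their entire boundaries.  An explicit collar of L extends the contraction of
    L to a homotopy of the whole complex ([extend_contraction]), so that
    collapsing L to a point is a homotopy equivalence
    ([collapse_homotopy_equivalent]).  The quotient is a wedge of spheres, one of
    dimension #|s| - 1 for each critical face s ([realization_bouquet]): an
    explicit rational map identifies a simplex modulo its boundary with a sphere.

    It remains to count critical faces by their number of central vertices.
    With none they have exactly two nonzero vertices in each of the n leaf
    cliques: 'C(r - 1, 2) ^ n faces of dimension 2 n - 1.  With two they are the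
    edges of the central clique.  With one they all have dimension d, and since
    the matching changes the parity of the cardinality their number is, up to
    sign, the alternating sum over all faces with one central vertex, that is
    r times f_(d-1)(r, n-1) ([card_critical_with_centre1]). *)

(** * Continuity and compactness *)

Lemma continuous_const (X Y : topologicalType) (c : Y) :
  continuous (fun _ : X => c).
Proof. by move=> x; exact: cvg_cst. Qed.

Lemma continuous_funcomp (X Y Z : topologicalType) (f : X -> Y) (g : Y -> Z) :
  continuous f -> continuous g -> continuous (fun x => g (f x)).
Proof. by move=> fc gc x; exact: (continuous_comp (fc x) (gc _)). Qed.

Lemma continuous_pair (X Y Z : topologicalType) (f : X -> Y) (g : X -> Z) :
  continuous f -> continuous g -> continuous (fun x => (f x, g x)).
Proof. by move=> fc gc x; apply: cvg_pair; [exact: fc|exact: gc]. Qed.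

Lemma continuous_fst (X Y : topologicalType) : continuous (@fst X Y).
Proof. by move=> x; exact: cvg_fst. Qed.

Lemma continuous_snd (X Y : topologicalType) : continuous (@snd X Y).
Proof. by move=> x; exact: cvg_snd. Qed.

Section RealValuedMaps.
Variables (R : realType) (T : topologicalType).
Implicit Types f g : T -> R.

Lemma continuous_add f g :
  continuous f -> continuous g -> continuous (fun x => f x + g x).
Proof. by move=> fc gc x; exact: (cvgD (fc x) (gc x)). Qed.

Lemma continuous_opp f : continuous f -> continuous (fun x => - f x).
Proof. by move=> fc x; exact: (cvgN (fc x)). Qed.

Lemma continuous_mul f g :
  continuous f -> continuous g -> continuous (fun x => f x * g x).
Proof. by move=> fc gc x; exact: (cvgM (fc x) (gc x)). Qed.

Lemma continuous_div f g : continuous f -> continuous g ->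
  (forall x, g x != 0) -> continuous (fun x => f x / g x).
Proof.
by move=> fc gc g0 x; apply: (cvgM (fc x)); exact: (cvgV (g0 x) (gc x)).
Qed.

Lemma continuous_minr f g :
  continuous f -> continuous g -> continuous (fun x => Num.min (f x) (g x)).
Proof. by move=> fc gc x; exact: (continuous_min (fc x) (gc x)). Qed.

Lemma continuous_maxr f g :
  continuous f -> continuous g -> continuous (fun x => Num.max (f x) (g x)).
Proof. by move=> fc gc x; exact: (continuous_max (fc x) (gc x)). Qed.

Lemma continuous_sumr (I : Type) (r : seq I) (P : pred I) (F : I -> T -> R) :
  (forall i, continuous (F i)) ->
  continuous (fun x => \sum_(i <- r | P i) F i x).
Proof. by move=> Fc; apply: continuous_big => //; exact: add_continuous. Qed.

Lemma continuous_bigminr (I : Type) (r : seq I) (P : pred I)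
    (F : I -> T -> R) :
  (forall i, continuous (F i)) ->
  continuous (fun x => \big[Num.min/1]_(i <- r | P i) F i x).
Proof.
move=> Fc; apply: continuous_big => // p.
exact: (continuous_min (@continuous_fst R R p) (@continuous_snd R R p)).
Qed.
End RealValuedMaps.

Section Coordinates.
Variables (R : realType) (V : Type) (T : topologicalType).

Lemma continuous_into_prod (f : T -> prod_topology (fun _ : V => R)) :
  (forall v, continuous (fun t => f t v)) -> continuous f.
Proof.
move=> fc x; apply/cvg_sup => v U [_ [[B oB <-] /= Bx] sBU].
apply: (@filterS _ _ _ (fun t => B (f t v))); first by move=> t; exact: sBU.
by apply: (fc v x); exact: open_nbhs_nbhs.
Qed.

Lemma coordinate_continuous (v : V) :
  continuous (fun x : prod_topology (fun _ : V => R) => x v).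
Proof. by have /(_ v) := @proj_continuous {classic V} (fun _ => R). Qed.
End Coordinates.

Lemma continuous_into_sub (X T : topologicalType) (A : set X) (f : T -> A) :
  continuous (fun t => set_val (f t)) -> continuous f.
Proof.
move=> /continuousP fc; apply/continuousP => _ [B oB <-].
exact: (fc B oB).
Qed.

Lemma continuous_into_rV (R : realType) (k : nat) (T : topologicalType)
    (f : T -> 'rV[R]_k) :
  (forall i, continuous (fun t => f t 0 i)) -> continuous f.
Proof.
move=> fc x U [P Px PU]; rewrite /= nbhs_simpl.
have : \forall t \near x, forall i : 'I_k, P 0 i (f t 0 i).
  by apply: filter_forall => i; apply: (fc i x); exact: Px.
by apply: filterS => t Pt; apply: PU => i j; rewrite (ord1 i).
Qed.

Lemma hausdorff_sub (X : topologicalType) (A : set X) :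
  hausdorff_space X -> hausdorff_space A.
Proof.
move=> hX x y clxy; apply: val_inj; apply: hX => B C.
move=> /(initial_continuous (f := set_val)) Bx.
move=> /(initial_continuous (f := set_val)) Cy.
by have [z [Bz Cz]] := clxy _ _ Bx Cy; exists (val z).
Qed.

Lemma compact_sub (X : topologicalType) (A : set X) :
  compact A -> compact [set: A].
Proof.
move=> cA F FF _.
have FA : (set_val @ F) A.
  by rewrite /= nbhs_simpl; apply: filterE => x; exact: set_valP.
have [x [Ax clx]] := cA _ _ FA.
exists (exist _ x (mem_set Ax)); split=> // B C FB [_ [[D oD <-] /= Dx] sDC].
have /clx : (set_val @ F) (set_val @` B).
  by rewrite /= nbhs_simpl; apply: filterS FB => z Bz; exists z.
move=> /(_ D) [|_ [[z Bz <-] Dz]]; first exact: open_nbhs_nbhs.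
by exists z; split=> //; exact: sDC.
Qed.

(** A continuous map from a compact set to a Hausdorff space is closed, hence a
    quotient map onto its image.  Allowing a set [A] that is not the whole space
    makes the lemma apply to homotopies, which are continuous on a product with
    the unit interval only. *)
Lemma continuous_from_compact_image (Y Z T : topologicalType) (A : set Y)
    (k : Y -> Z) (phi : Z -> T) :
  compact A -> hausdorff_space Z -> continuous k ->
  {within A, continuous (phi \o k)} ->
  {within k @` A, continuous phi}.
Proof.
move=> cA hZ kc phikc; apply/continuous_closedP => C cC.
apply/closed_subspaceP.
exists (k @` (A `&` (phi \o k) @^-1` C)); last first.
  apply/seteqP; split=> z [].
    by move=> [y [Ay Cy] <-] _; split=> //; exists y.
  by move=> Cz [y Ay yz]; split; exists y => //; split=> //=; rewrite yz.
apply: compact_closed => //; apply: continuous_compact.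
  exact: continuous_subspaceT.
have /continuous_closedP/(_ C cC)/closed_subspaceP[D cD DA] := phikc.
by rewrite setIC -DA setIC; exact: compact_closedI.
Qed.

(** * Collapsing a contractible subspace *)

Section Homotopies.
Variable R : realType.

(** Homotopies of polyhedra below are continuous for all real times; clamping the
    time lets them be concatenated by composition, without pasting. *)
Definition clamp (t : R) : R := Num.min (Num.max t 0) 1.

Lemma clamp_ge0 t : 0 <= clamp t.
Proof. by rewrite /clamp le_min le_max lexx orbT ler01. Qed.

Lemma clamp_le1 t : clamp t <= 1.
Proof. by rewrite /clamp ge_min lexx orbT. Qed.

Lemma clamp_le0 t : t <= 0 -> clamp t = 0.
Proof. by move=> t0; rewrite /clamp max_r// min_l. Qed.

Lemma clamp_ge1 t : 1 <= t -> clamp t = 1.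
Proof. by move=> t1; rewrite /clamp min_r// le_max t1. Qed.

Lemma clamp_continuous : continuous clamp.
Proof.
move=> t; apply: (@continuous_min R R (fun u => Num.max u 0) (fun=> 1)).
  by apply: (@continuous_max R R id (fun=> 0)); [exact: cvg_id|exact: cvg_cst].
exact: cvg_cst.
Qed.

Definition contracts_within (X : topologicalType) (h : X * R -> X) (L : set X)
    (x0 : X) :=
  [/\ continuous h, forall x, h (x, 0) = x,
      forall x t, L x -> L (h (x, t)) & forall x, L x -> h (x, 1) = x0].

(** Here [f] identifies [W] with the quotient of [X] by [L].  The end of [h]
    is constant on [L], so it factors through [f]; the factor is a homotopy
    inverse of [f], since [h] itself, and the homotopy that [h] induces on the
    quotient because it preserves [L], connect both composites to identities. *)
Lemma collapse_homotopy_equivalent (X W : topologicalType) (f : X -> W)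
    (L : set X) (h : X * R -> X) (x0 : X) :
  compact [set: X] -> hausdorff_space W -> continuous f ->
  (forall w, exists x, f x = w) ->
  (forall x y, f x = f y -> x = y \/ L x /\ L y) ->
  (forall x y, L x -> L y -> f x = f y) ->
  contracts_within h L x0 -> homotopy_equivalent R X W.
Proof.
move=> cX hW fc /choice[s sK] fI fL [hc h0 hL h1].
have hs x : h (s (f x), 1) = h (x, 1).
  by have /fI[->//|[Ls Lx]] := sK (f x); rewrite !h1.
have fhs x t : f (h (s (f x), t)) = f (h (x, t)).
  by have /fI[->//|[Ls Lx]] := sK (f x); apply: fL; exact: hL.
have revc : continuous (fun p : X * R => (p.1, 1 - p.2)).
  apply: continuous_pair; first exact: continuous_fst.
  apply: continuous_add => [?|]; first exact: cvg_cst.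
  exact/continuous_opp/continuous_snd.
(* The section s need not be continuous, but h (s (f x), 1) = h (x, 1) is
   continuous in x, and f is a quotient map. *)
exists f, (fun w => h (s w, 1)); split=> //.
- apply/continuous_subspace_setT.
  have -> : [set: W] = f @` setT.
    by apply/seteqP; split=> // w _; exists (s w).
  apply: continuous_from_compact_image => //.
  apply: continuous_subspaceT.
  rewrite (_ : _ \o _ = fun x => h (x, 1)); last exact/funext.
  have pc : continuous (fun x : X => (x, 1 : R)).
    by apply: continuous_pair => x; [exact: cvg_id | exact: cvg_cst].
  exact: continuous_funcomp pc hc.
- exists (fun p => h (p.1, 1 - p.2)) => [|x].
    apply: continuous_subspaceT.
    exact: continuous_funcomp revc hc.
  by rewrite /= subr0 subrr h0 hs.
exists (fun p => f (h (s p.1, 1 - p.2))) => [|w]; last first.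
  by rewrite /= subr0 subrr h0 sK.
have -> : [set: W] `*` `[0, 1] =
    (fun p : X * R => (f p.1, p.2)) @` ([set: X] `*` `[0, 1]) :> set (W * R).
  apply/seteqP; split=> [[w t] [_ /= t01]|_ [[x t] [_ /= t01] <-]] //.
  by exists (s w, t); rewrite //= sK.
apply: continuous_from_compact_image.
- by apply: compact_setX => //; exact: segment_compact.
- move=> [w1 t1] [w2 t2] cl; congr (_, _).
    apply: hW => A B Aw Bw.
    have [] := cl (A `*` setT) (B `*` setT).
    + by exists (A, setT) => //; split=> //; exact: filterT.
    + by exists (B, setT) => //; split=> //; exact: filterT.
    by move=> [w t] [[/= Aw' _] [Bw' _]]; exists w.
  apply: Rhausdorff => A B At Bt.
  have [] := cl (setT `*` A) (setT `*` B).
  + by exists (setT, A) => //; split=> //; exact: filterT.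
  + by exists (setT, B) => //; split=> //; exact: filterT.
  by move=> [w t] [[/= _ At'] [_ Bt']]; exists t.
- apply: continuous_pair; last exact: continuous_snd.
  exact: continuous_funcomp (@continuous_fst X R) fc.
apply: continuous_subspaceT.
rewrite (_ : _ \o _ = fun p => f (h (p.1, 1 - p.2))); last first.
  by apply/funext => p /=.
exact: continuous_funcomp (continuous_funcomp revc hc) fc.
Qed.
End Homotopies.

(** * Deforming polyhedra along acyclic matchings *)

Section Polyhedra.
Variables (R : realType) (V : finType).
Local Notation E := (prod_topology (fun _ : V => R)).
Implicit Types (x : E) (L : {set V} -> Prop) (s : {set V}).

Definition support x : {set V} := [set v | x v != 0]%SET.

Definition polyhedron L : set E :=
  [set x | [/\ forall v, 0 <= x v, \sum_(v : V) x v = 1 & L (support x)]].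

(** On a simplex [s] this is the least barycentric coordinate, which vanishes
    exactly on the boundary.  The default value 1 is harmless there, because
    coordinates are at most 1, and it makes [least s] a total continuous map. *)
Definition least s x : R := \big[Num.min/1]_(v in s) x v.

Lemma least_continuous s : continuous (least s).
Proof. by apply: continuous_bigminr => v; exact: coordinate_continuous. Qed.

Lemma least_le s x v : v \in s -> least s x <= x v.
Proof. by move=> vs; exact: bigmin_le_cond. Qed.

Lemma least_gt0 s x : (forall v, v \in s -> 0 < x v) -> 0 < least s x.
Proof. by move=> xs; apply: lt_bigmin. Qed.

Lemma least_ge0 s x : (forall v, 0 <= x v) -> 0 <= least s x.
Proof. by move=> x0; apply: le_bigmin. Qed.

Lemma coordinate_le1 x v :
  (forall v, 0 <= x v) -> \sum_(v : V) x v = 1 -> x v <= 1.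
Proof. by move=> x0 <-; rewrite (bigD1 v) //= lerDl sumr_ge0. Qed.

Lemma least_attained s x : (forall v, 0 <= x v) -> \sum_(v : V) x v = 1 ->
  s != finset.set0 -> exists2 v, v \in s & least s x = x v.
Proof.
move=> x0 x1 /finset.set0Pn[w ws].
have [|v vs xv] := @eq_bigmin _ _ _ 1 w (fun v => v \in s) x ws.
  by move=> v _; exact: coordinate_le1.
by exists v.
Qed.

Lemma least_eq0 s x : (forall v, 0 <= x v) -> ~~ (s \subset support x) ->
  least s x = 0.
Proof.
move=> x0 /fintype.subsetPn[v vs]; rewrite !inE negbK => /eqP xv.
by apply/eqP; rewrite eq_le least_ge0// andbT -xv least_le.
Qed.

Lemma support_gt0 s x : (forall v, 0 <= x v) -> s \subset support x ->
  forall v, v \in s -> 0 < x v.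
Proof.
by move=> x0 /fintype.subsetP sx v /sx; rewrite lt_def x0 inE andbT.
Qed.

Lemma polyhedron_subset L L' : (forall s, L s -> L' s) ->
  polyhedron L `<=` polyhedron L'.
Proof. by move=> LL x [x0 x1 Lx]; split=> //; exact: LL. Qed.

(** The homotopy is required on the whole space of coordinate functions, not
    just on [P]: this is what makes deformations of subcomplexes composable and
    extendable without pasting continuous maps together. *)
Definition deform (P Q : set E) : Prop := exists C : E * R -> E,
  [/\ continuous C, forall x, C (x, 0) = x,
      forall x t, P x -> P (C (x, t)) & forall x, P x -> Q (C (x, 1))].

Lemma deform_subset P Q : P `<=` Q -> deform P Q.
Proof.
move=> PQ; exists fst; split=> //=; exact: continuous_fst.
Qed.

Lemma deform_trans P Q S :
  Q `<=` P -> deform P Q -> deform Q S -> deform P S.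
Proof.
move=> QP [C [Cc C0 CP C1]] [D [Dc D0 DQ D1]].
exists (fun p => D (C (p.1, clamp (2 * p.2)), clamp (2 * p.2 - 1))).
have tc : continuous (fun p : E * R => 2 * p.2).
  apply: continuous_mul; last exact: continuous_snd.
  exact: continuous_const.
split.
- apply: (continuous_funcomp _ Dc); apply: continuous_pair.
    apply: (continuous_funcomp _ Cc); apply: continuous_pair.
      exact: continuous_fst.
    exact: (continuous_funcomp tc (@clamp_continuous R)).
  apply: (continuous_funcomp _ (@clamp_continuous R)).
  by apply: continuous_add => //; exact: continuous_const.
- by move=> x /=; rewrite mulr0 sub0r (clamp_le0 (lexx 0)) clamp_le0 ?D0 ?C0//; lra.
- move=> x t Px /=; have [t1|t1] := lerP (2 * t) 1.
    by rewrite (@clamp_le0 _ (2 * t - 1)) ?D0; [exact: CP|move: t1; clear; lra].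
  by apply/QP/DQ; rewrite clamp_ge1 ?(ltW t1)//; exact: C1.
- by move=> x Px /=; rewrite !clamp_ge1; [apply/D1/C1|clear; lra|clear; lra].
Qed.

(** An elementary collapse.  The face [s] lies in no face of [L] other than
    itself and [v |: s], so taking an equal mass off all the vertices of [s] and
    putting it on [v], until some vertex of [s] is exhausted, stays inside the
    simplex [v |: s].  Points whose support does not contain [s] do not move. *)
Lemma deform_elementary L s v :
  s != finset.set0 -> v \notin s -> L (v |: s)%SET ->
  (forall t t' : {set V}, t' \subset t -> L t -> L t') ->
  (forall t, L t -> s \subset t -> t = s \/ t = (v |: s)%SET) ->
  deform (polyhedron L) (polyhedron (fun t => L t /\ ~~ (s \subset t))).
Proof.
move=> s0 vs Lvs Ldown Lfree.
pose dir w : R := #|s|%:R * (w == v)%:R - (w \in s)%:R.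
pose C (p : E * R) : E :=
  fun w => p.1 w + clamp p.2 * least s p.1 * dir w.
have dir0 : \sum_w dir w = 0.
  rewrite sumrB -mulr_sumr (bigD1 v) //= eqxx big1 => [|w /negPf -> //].
  rewrite addr0 mulr1 -sum1_card natr_sum [X in X - _]big_mkcond /=.
  by rewrite -sumrB big1// => w _; case: ifP; rewrite subrr.
have CP x t : polyhedron L x ->
    [/\ forall w, 0 <= C (x, t) w, \sum_w C (x, t) w = 1 &
        L (support (C (x, t)))].
  move=> [x0 x1 Lx]; split=> [w||].
  - rewrite /C /= /dir; have [ws|ws] := boolP (w \in s).
      have -> : (w == v) = false by apply/negP => /eqP wv; rewrite -wv ws in vs.
      have := least_le x ws; have := least_ge0 s x0.
      have := clamp_ge0 t; have := clamp_le1 t; rewrite mulr0 sub0r mulrN1.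
      by move: (least s x) (clamp t) (x w) => m c y *; nra.
    rewrite subr0 addr_ge0 ?mulr_ge0 ?clamp_ge0 ?least_ge0 //.
  - by rewrite big_split /= -mulr_sumr dir0 mulr0 addr0.
  have [sx|sx] := boolP (s \subset support x); last first.
    rewrite (_ : C (x, t) = x) //; apply/funext => w.
    by rewrite /C /= least_eq0// mulr0 mul0r addr0.
  apply: (Ldown (v |: s)%SET) => //; apply/fintype.subsetP => w.
  apply: contraTT => wvs; rewrite inE negbK /C /= /dir.
  move: wvs; rewrite !inE negb_or => /andP[/negPf wv /negPf ws].
  have : w \notin support x.
    by have [->|->] := Lfree _ Lx sx; rewrite ?inE ?wv ws.
  by rewrite inE negbK => /eqP ->; rewrite wv ws mulr0 subr0 mulr0 addr0.
exists C; split.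
- apply: continuous_into_prod => w; apply: continuous_add.
    exact: (continuous_funcomp (@continuous_fst _ _) (@coordinate_continuous _ _ w)).
  apply: continuous_mul; last exact: continuous_const.
  apply: continuous_mul.
    exact: (continuous_funcomp (@continuous_snd _ _) (@clamp_continuous R)).
  exact: (continuous_funcomp (@continuous_fst _ _) (@least_continuous s)).
- by move=> x; apply/funext => w; rewrite /C /= clamp_le0// !mul0r addr0.
- by move=> x t Px; exact: (CP x t Px).
- move=> x Px; have [C0 C1 CL] := CP x 1 Px; split=> //; split=> //.
  have [x0 x1 Lx] := Px.
  have [w ws lw] := least_attained x0 x1 s0.
  apply/fintype.subsetPn; exists w => //; rewrite inE negbK /C /= /dir ws.
  have -> : (w == v) = false by apply/negP => /eqP wv; rewrite -wv ws in vs.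
  by rewrite clamp_ge1// lw mulr0 sub0r mul1r mulrN1 subrr.
Qed.

Section Matching.
Variables (p : {set V} -> V) (rank : {set V} -> nat) (v0 : V).

Definition toggle_at s : {set V} :=
  (if p s \in s then s :\ p s else p s |: s)%SET.

(** Toggling [p s] pairs the faces.  Removing the pairs by decreasing rank, each
    removal is an elementary collapse, because a face of another pair that
    contains the lower face of a pair of maximal rank would have a larger rank;
    the last pair consists of the empty face and the vertex [v0]. *)
Lemma deform_matched (L : {set {set V}}) :
  (forall s t : {set V}, t \subset s -> s \in L -> t \in L) ->
  p finset.set0 = v0 ->
  (forall s, s \in L -> [/\ toggle_at s \in L, p (toggle_at s) = p s &
                            rank (toggle_at s) = rank s]) ->
  (forall s t : {set V}, s \in L -> t \in L -> p s \notin s -> s \subset t ->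
     t != s -> t != (p s |: s)%SET -> (rank s < rank t)%N) ->
  deform (polyhedron (fun s => s \in L))
         (polyhedron (fun s => s \subset [set v0]%SET)).
Proof.
have [n] := ubnP #|L|; elim: n L => // n IHn L Ln Ldown p0 Ltog Lrank.
have toggleK s : s \in L -> toggle_at (toggle_at s) = s.
  move=> sL; have [_ + _] := Ltog s sL; rewrite /toggle_at.
  case: ifPn => pss ps; rewrite ps !inE eqxx /=; first exact: finset.setD1K.
  exact: finset.setU1K.
pose B := [set s in L | ~~ (s \subset [set v0])]%SET.
have [B0|/finset.set0Pn[s1 s1B]] := eqVneq B finset.set0.
  apply/deform_subset/polyhedron_subset => s sL; apply/negPn/negP => sv0.
  by have : s \in B by [rewrite inE sL]; rewrite B0 inE.
have [s2 s2B s2max] := @arg_maxnP _ s1 (mem B) rank s1B.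
(* s is the lower face of the pair of s2, and v |: s is the upper one *)
pose v := p s2; pose s := (s2 :\ v)%SET.
have /[!inE]/andP[s2L s2v0] := s2B.
have [ts2L pts2 rts2] := Ltog _ s2L.
have [sL [vsL [ps rs]]] :
    s \in L /\ (v |: s)%SET \in L /\ p s = v /\ rank s = rank s2.
  move: ts2L pts2 rts2; rewrite /s /toggle_at -/v; case: ifPn => [vs2|vs2].
    by rewrite finset.setD1K.
  rewrite (_ : (s2 :\ v)%SET = s2) //; apply/finset.setP => w; rewrite !inE.
  by case: eqP => //= ->; rewrite (negPf vs2).
have vs : v \notin s by rewrite !inE eqxx.
have s0 : s != finset.set0.
  apply/eqP => s0; move/negP: s2v0; apply; apply/fintype.subsetP => w ws2.
  rewrite -p0 -s0 ps inE; apply: contraT => wv.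
  by have : w \in s by [rewrite !inE wv]; rewrite s0 inE.
have sfree t : t \in L -> s \subset t -> t = s \/ t = (v |: s)%SET.
  move=> tL st; have [->|ts] := eqVneq t s; first by left.
  have [->|tvs] := eqVneq t (v |: s)%SET; first by right.
  have srt : (rank s < rank t)%N by apply: Lrank => //; rewrite ps.
  have tB : t \in B.
    rewrite inE tL; apply: contra ts => tv0; rewrite finset.eqEsubset st andbT.
    suff -> : s = [set v0]%SET by [].
    apply/eqP; move: (fintype.subset_trans st tv0).
    by rewrite finset.subset1 (negPf s0) orbF.
  by have := s2max _ tB; rewrite -rs /= leqNgt srt.
pose L' := [set t in L | ~~ (s \subset t)]%SET.
apply: (@deform_trans _ (polyhedron (fun t => t \in L'))).
- by apply: polyhedron_subset => t /[!inE]/andP[].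
- have := @deform_elementary (fun t => t \in L) s v s0 vs vsL _ sfree.
  rewrite (_ : (fun t => _ /\ _) = fun t => is_true (t \in L')); last first.
    by apply/funext => t; rewrite inE; apply/propext; split=> /andP.
  by apply=> t t' tt' tL; exact: Ldown tt' tL.
apply: IHn => //.
- apply: leq_trans (proper_card _) Ln; apply/properP; split.
    by apply/fintype.subsetP => t /[!inE]/andP[].
  by exists s => //; rewrite !inE fintype.subxx andbF.
- move=> t t' tt' /[!inE]/andP[tL st]; rewrite (Ldown _ _ tt' tL) /=.
  by apply: contra st => st'; exact: fintype.subset_trans st' tt'.
- move=> t /[!inE]/andP[tL st]; have [ttL pt rt] := Ltog t tL; split=> //.
  rewrite ttL /=; apply: contra st => /(sfree _ ttL)[];
    rewrite -{2}(toggleK _ tL) => ->.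
    by rewrite /toggle_at ps (negPf vs) finset.subsetUr.
  have -> : toggle_at (v |: s)%SET = s.
    have : toggle_at s = (v |: s)%SET by rewrite /toggle_at ps (negPf vs).
    by move=> <-; rewrite toggleK.
  exact: fintype.subxx.
- by move=> t t' /[!inE]/andP[tL _] /andP[t'L _]; exact: Lrank.
Qed.
End Matching.

Lemma polyhedron_point v0 x y :
  polyhedron (fun s => s \subset [set v0]%SET) x ->
  polyhedron (fun s => s \subset [set v0]%SET) y -> x = y.
Proof.
have xE z w : polyhedron (fun s => s \subset [set v0]%SET) z -> z w = (w == v0)%:R.
  move=> [z0 z1 /fintype.subsetP zv0].
  have zw u : u != v0 -> z u = 0.
    by apply: contraNeq => zu; have := zv0 u; rewrite !inE; exact.
  have [->|/zw//] := eqVneq w v0.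
  by rewrite -[RHS]z1 (bigD1 v0) //= big1 ?addr0.
by move=> Px Py; apply/funext => w; rewrite !xE.
Qed.
End Polyhedra.

(** * Extending a contraction across maximal simplices *)

Section Collar.
Variables (R : realType) (V : finType) (K : scomplex V) (M : {set {set V}}).
Local Notation E := (prod_topology (fun _ : V => R)).
Local Notation X := (realization R K).
Hypothesis Mmax : forall s t : {set V},
  s \in M -> simplices K t -> s \subset t -> t = s.
Hypothesis M0 : finset.set0 \notin M.

Let L (s : {set V}) : Prop := simplices K s /\ s \notin M.

Let LE (x : E) : polyhedron (simplices K) x -> support x \notin M ->
  polyhedron L x.
Proof. by move=> [x0 x1 Kx] xM; split. Qed.

Lemma coordinates_polyhedron (x : X) : polyhedron (simplices K) (val x).
Proof. by case: x => x xK; exact: set_mem xK. Qed.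

Lemma point_coordinate_continuous v : continuous (fun x : X => val x v).
Proof.
apply: (@continuous_funcomp X E R set_val (fun x => x v)).
  exact: initial_continuous.
exact: coordinate_continuous.
Qed.

(** Inside a simplex of [M] the point [x - u x] is, up to scaling, the projection
    of [x] to the boundary from the barycentre; on [L] the vector [u x] is 0.
    The mass [mu x] of [u x] measures the distance to [L]. *)
Let u (x : E) (w : V) : R := \sum_(s in M) least s x * (w \in s)%:R.
Let mu (x : E) : R := \sum_w u x w.

Lemma least_maximal_eq0 (x : E) (s : {set V}) :
  polyhedron (simplices K) x -> s \in M -> s != support x -> least s x = 0.
Proof.
move=> [x0 x1 Kx] sM sx; apply: least_eq0 => //; apply: contra sx => sx.
by rewrite (Mmax sM Kx sx).
Qed.

Let uM (x : E) : polyhedron (simplices K) x -> support x \in M ->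
  forall w, u x w = least (support x) x * (w \in support x)%:R.
Proof.
move=> Px xM w; rewrite /u (bigD1 (support x)) //= big1 ?addr0// => s.
by move=> /andP[sM sx]; rewrite (least_maximal_eq0 Px sM sx) mul0r.
Qed.

Let uL (x : E) : polyhedron (simplices K) x -> support x \notin M ->
  forall w, u x w = 0.
Proof.
move=> Px xM w; rewrite /u big1// => s sM.
rewrite (least_maximal_eq0 Px sM) ?mul0r//.
by apply: contraNneq xM => <-.
Qed.

Let u_bounds (x : E) : polyhedron (simplices K) x ->
  forall w, 0 <= u x w <= x w.
Proof.
move=> Px w; have [x0 x1 Kx] := Px.
have [xM|xM] := boolP (support x \in M); last by rewrite uL// lexx x0.
rewrite uM//; have [wx|wx] := boolP (w \in support x).
  by rewrite mulr1 least_ge0//= least_le.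
by rewrite mulr0 lexx x0.
Qed.

Let mu_bounds (x : E) : polyhedron (simplices K) x -> 0 <= mu x <= 1.
Proof.
move=> Px; have [x0 x1 Kx] := Px; rewrite /mu; apply/andP; split.
  by apply: sumr_ge0 => w _; have /andP[] := u_bounds Px w.
by rewrite -x1; apply: ler_sum => w _; have /andP[] := u_bounds Px w.
Qed.

(** The factor is the time on the collar, where [mu x] is at most 1/2, and it
    decreases to 0 at the barycentres, which have [mu x = 1] and no well-defined
    projection to the boundary. *)
Let damp (x : E) (t : R) : R := clamp t * Num.min 1 (2 * (1 - mu x)).

Let damp_bounds (x : E) t : polyhedron (simplices K) x ->
  [/\ 0 <= damp x t, damp x t <= 1 & 0 < 1 - damp x t * mu x].
Proof.
move=> /mu_bounds; rewrite /damp; have := clamp_ge0 t; have := clamp_le1 t.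
move: (clamp t) (mu x) => c m c1 c0 /andP[m0 m1].
set d := Num.min _ _.
have [d0 d1 dm] : [/\ 0 <= d, d <= 1 & d * m <= 1 / 2].
  have sq : 0 <= (1 - 2 * m) * (1 - 2 * m) by rewrite -expr2 sqr_ge0.
  by rewrite /d; case: (lerP 1 (2 * (1 - m))) => h; split; nra.
have dm0 : 0 <= d * m by rewrite mulr_ge0.
by split; rewrite -?mulrA; move: (d * m) dm dm0 => dm *; nra.
Qed.

(** At time 1 this pushes the collar of [L] onto [L] along rays from the
    barycentres; dividing by the remaining mass restores the total mass 1. *)
Let push (x : E) (t : R) : E :=
  fun w => (x w - damp x t * u x w) / (1 - damp x t * mu x).

Let push_polyhedron (x : E) t : polyhedron (simplices K) x ->
  polyhedron (simplices K) (push x t).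
Proof.
move=> Px; have [x0 x1 Kx] := Px; have [d0 d1 dm] := damp_bounds t Px.
split=> [w||].
- rewrite divr_ge0 ?(ltW dm)// subr_ge0; have /andP[u0 ux] := u_bounds Px w.
  by apply: le_trans ux; rewrite ler_piMl.
- by rewrite -mulr_suml sumrB -mulr_sumr x1 divff// gt_eqF.
apply: (simplices_down _ Kx); apply/fintype.subsetP => w; rewrite !inE.
apply: contraNneq => xw; have := u_bounds Px w; rewrite xw -eq_le => /eqP uw.
by rewrite /push xw -uw mulr0 subr0 mul0r.
Qed.

Let push_id (x : E) t : polyhedron (simplices K) x -> support x \notin M ->
  push x t = x.
Proof.
move=> Px xM; apply/funext => w; rewrite /push /mu.
by under eq_bigr do rewrite uL//; rewrite big1// uL// !mulr0 !subr0 divr1.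
Qed.

Let push0 (x : E) : push x 0 = x.
Proof.
by apply/funext => w; rewrite /push /damp clamp_le0// !mul0r !subr0 divr1.
Qed.

Let push1 (x : E) : polyhedron (simplices K) x -> mu x <= 1 / 2 ->
  polyhedron L (push x 1).
Proof.
move=> Px mx; have Ppx := push_polyhedron 1 Px.
have [xM|xM] := boolP (support x \in M); last first.
  by rewrite push_id//; exact: LE.
apply: LE => //; have [x0 x1 Kx] := Px.
have dx : damp x 1 = 1 by rewrite /damp clamp_ge1// mul1r min_l//; lra.
have [|w wx lw] := least_attained (s := support x) x0 x1.
  by apply: contraNneq M0 => <-.
have psx : support (push x 1) \subset support x.
  apply/fintype.subsetP => w'; rewrite !inE.
  apply: contraNneq => xw; have := u_bounds Px w'; rewrite xw -eq_le => /eqP uw.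
  by rewrite /push xw -uw mulr0 subr0 mul0r.
apply/negP => pM; have pE := Mmax pM Kx psx.
have : w \in support (push x 1) by rewrite -pE.
by rewrite inE /push dx mul1r uM// wx -lw mulr1 subrr mul0r eqxx.
Qed.

Let mu_continuous (Z : topologicalType) (f : Z -> E) :
  continuous f -> continuous (fun z => mu (f z)).
Proof.
move=> fc; apply: continuous_sumr => w; apply: continuous_sumr => s.
apply: continuous_mul; last exact: continuous_const.
exact: (continuous_funcomp fc (@least_continuous _ _ s)).
Qed.

Let push_continuous : continuous (fun p : X * R => push (val p.1) p.2).
Proof.
have vc : continuous (fun p : X * R => val p.1 : E).
  exact: (continuous_funcomp (@continuous_fst X R)
                             (@initial_continuous _ _ set_val)).
have dc : continuous (fun p : X * R => damp (val p.1) p.2).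
  apply: continuous_mul.
    exact: (continuous_funcomp (@continuous_snd X R) (@clamp_continuous R)).
  apply: continuous_minr; first exact: continuous_const.
  apply: continuous_mul; first exact: continuous_const.
  apply: continuous_add; first exact: continuous_const.
  exact/continuous_opp/mu_continuous.
apply: continuous_into_prod => w; apply: continuous_div.
- apply: continuous_add.
    exact: (continuous_funcomp vc (@coordinate_continuous _ _ w)).
  apply/continuous_opp/continuous_mul => //; apply: continuous_sumr => s.
  apply: continuous_mul; last exact: continuous_const.
  exact: (continuous_funcomp vc (@least_continuous _ _ s)).
- apply: continuous_add; first exact: continuous_const.
  by apply/continuous_opp/continuous_mul => //; exact: mu_continuous.
move=> p; have [_ _ dm] := damp_bounds p.2 (coordinates_polyhedron p.1).
by rewrite gt_eqF.
Qed.

Lemma vertex_point v0 : simplices K [set v0]%SET ->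
  exists x : X, support (val x) = [set v0]%SET.
Proof.
move=> Kv0; pose d : E := fun v => (v == v0)%:R.
have sd : support d = [set v0]%SET.
  by apply/finset.setP => v; rewrite !inE pnatr_eq0 eqb0 negbK.
have Pd : d \in @realization_set R V K.
  apply/mem_set; split=> [v||]; first exact: ler0n.
    by rewrite (bigD1 v0) //= /d eqxx big1 ?addr0// => v /negPf ->.
  by rewrite -[X in simplices _ X]/(support d) sd.
by exists (exist _ d Pd).
Qed.

(** After the collar has been pushed onto [L], the contraction [C] of [L] runs
    on the images of its points with a speed that vanishes at its outer edge,
    so the points outside of the collar need not be moved any more. *)
Lemma extend_contraction v0 :
  simplices K [set v0]%SET -> [set v0]%SET \notin M ->
  deform (polyhedron (R := R) L)
         (polyhedron (fun s => s \subset [set v0]%SET)) ->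
  exists (h : X * R -> X) x0,
    contracts_within h [set x : X | support (val x) \notin M] x0.
Proof.
move=> Kv0 v0M [C [Cc C0 CL C1]].
have LK (y : E) : polyhedron L y -> polyhedron (simplices K) y.
  by apply: polyhedron_subset => s [].
pose time (p : X * R) : R :=
  clamp (2 * p.2 - 1) * Num.max 0 (1 - 2 * mu (val p.1)).
pose H (p : X * R) : E := C (push (val p.1) (2 * p.2), time p).
have HK p : polyhedron (simplices K) (H p).
  have Px := coordinates_polyhedron p.1; rewrite /H /time.
  have Ppx := push_polyhedron (2 * p.2) Px.
  have [t1|t1] := lerP (2 * p.2 - 1) 0; first by rewrite clamp_le0// mul0r C0.
  have [m0|m0] := lerP (1 - 2 * mu (val p.1)) 0; first by rewrite mulr0 C0.
  apply/LK/CL; have := push1 Px; rewrite /push /damp !(@clamp_ge1 _ 1)//.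
  rewrite (@clamp_ge1 _ (2 * p.2)); last by lra.
  by apply; lra.
have HX (p : X * R) : H p \in @realization_set R V K by exact/mem_set/HK.
pose h (p : X * R) : X := exist _ (H p) (HX p).
have hL (x : X) t : support (val x) \notin M -> polyhedron L (H (x, t)).
  move=> xM; have Px := coordinates_polyhedron x.
  by apply: CL; rewrite push_id//; exact: LE.
have muL (x : X) : support (val x) \notin M -> mu (val x) = 0.
  move=> xM; rewrite /mu big1// => w _; apply: uL => //.
  exact: coordinates_polyhedron.
have [hc h0] : continuous h /\ forall x, h (x, 0) = x.
  split; last first.
    move=> x; apply/val_inj; rewrite /= /H /= mulr0 push0 /time /= clamp_le0.
      by rewrite mul0r C0.
    by rewrite mulr0 sub0r; lra.
  apply: continuous_into_sub; apply: (continuous_funcomp _ Cc).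
  have tc : continuous (fun p : X * R => 2 * p.2).
    by apply: continuous_mul; [exact: continuous_const|exact: continuous_snd].
  have vc : continuous (fun p : X * R => val p.1 : E).
    exact: (continuous_funcomp (@continuous_fst X R)
                               (@initial_continuous _ _ set_val)).
  apply: continuous_pair.
    have pc : continuous (fun p : X * R => (p.1, 2 * p.2)).
      by apply: continuous_pair => //; exact: continuous_fst.
    exact: (continuous_funcomp pc push_continuous).
  apply: continuous_mul.
    apply: (continuous_funcomp _ (@clamp_continuous R)).
    by apply: continuous_add => //; exact: continuous_const.
  apply: (@continuous_maxr R); first exact: continuous_const.
  apply: continuous_add; first exact: continuous_const.
  apply/continuous_opp/continuous_mul; first exact: continuous_const.
  exact: mu_continuous.
have h1 (x y : X) : support (val x) \notin M -> support (val y) \notin M ->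
    h (x, 1) = h (y, 1).
  move=> xM yM; apply/val_inj => /=; rewrite /H /time /= !muL// mulr0 subr0.
  rewrite max_r// clamp_ge1; last by lra.
  rewrite mul1r !push_id//; try exact: coordinates_polyhedron.
  apply: (@polyhedron_point _ _ v0); apply: C1; apply: LE => //;
    exact: coordinates_polyhedron.
have [x0 sx0] := vertex_point Kv0; have x0M : support (val x0) \notin M.
  by rewrite sx0.
exists h, (h (x0, 1)); split=> // [x t xM|x xM]; last exact: h1.
by have [_ _ []] := hL x t xM.
Qed.
End Collar.

Lemma realization_compact (R : realType) (V : finType) (K : scomplex V) :
  compact [set: realization R K].
Proof.
apply: compact_sub; pose box : set (prod_topology (fun _ : V => R)) :=
  [set x | forall v, `[0, 1]%classic (x v)].
have cbox : compact box.
  by have /(_ (fun=> @segment_compact R 0 1)) :=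
    @tychonoff V (fun=> R) (fun=> `[0, 1]%classic).
have cE := @coordinate_continuous R V.
have closed_sum : closed [set x : prod_topology (fun _ : V => R) | \sum_v x v = 1].
  have /continuous_closedP := @continuous_sumr R _ _ (index_enum V) xpredT _ cE.
  by move=> /(_ [set 1]); apply; exact: closed_eq.
(* the set of x with support in K is cut out by the non-faces of K *)
have closed_support : closed [set x : prod_topology (fun _ : V => R) |
    forall s, ~ simplices K s -> exists2 v, v \in s & x v = 0].
  rewrite (_ : mkset _ = \bigcap_(s in [set s | ~ simplices K s])
      \bigcup_(v in [set v | v \in s]) [set x | x v = 0]).
    apply: closed_bigI => s _; apply: closed_bigcup => [|v _].
      exact: finite_finset.
    by have /continuous_closedP/(_ [set 0]) := cE v; apply; exact: closed_eq.
  apply/seteqP; split=> x xK s sK; have [v vs xv] := xK s sK; exists v => //.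
rewrite (_ : realization_set _ = box `&` ([set x | \sum_v x v = 1] `&`
  [set x | forall s, ~ simplices K s -> exists2 v, v \in s & x v = 0])).
  by apply: compact_closedI => //; exact: closedI.
apply/seteqP; split=> x.
  move=> [x0 x1 Kx]; split=> [v|].
    by rewrite /= in_itv /= x0 coordinate_le1.
  split=> // s sK; apply: contrapT => sx; apply: sK; apply: simplices_down Kx.
  apply/fintype.subsetP => v vs; rewrite inE; apply/eqP => xv.
  by apply: sx; exists v.
move=> [xb [x1 xK]]; split=> // [v|].
  by have := xb v; rewrite /= in_itv /= => /andP[].
apply: contrapT => /xK[v]; rewrite inE => /negP + xv; apply.
by rewrite xv.
Qed.

(** * A simplex modulo its boundary is a sphere *)

Section SphereQuotient.
Variables (R : realType) (V : finType) (K : scomplex V).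
Local Notation E := (prod_topology (fun _ : V => R)).
Local Notation X := (realization R K).
Variables (k : nat) (e : 'I_k.+1 -> V).
Hypothesis e_inj : injective e.
Let s : {set V} := (e @: [set: 'I_k.+1])%SET.
Hypothesis Ks : simplices K s.
Hypothesis smax : forall t : {set V}, simplices K t -> s \subset t -> t = s.

Let es i : e i \in s.
Proof. by apply/finset.imsetP; exists i. Qed.

Implicit Types x : E.

Let slope x i : R := x (e i) - x (e 0).
(** Write z for the vector of slopes.  On the simplex [s], dividing z by the least
    coordinate identifies the interior with R^k, and sends the boundary to
    infinity; [quot] composes this with the inverse stereographic projection
    from the base point.  The summand involving the total mass vanishes on [s];
    it keeps the denominator positive, so that [quot] is continuous on the whole
    realization and constant outside of the interior of [s]. *)
Let spread (x : E) : R :=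
  \sum_i slope x i ^+ 2 + (1 - \sum_i x (e i)) ^+ 2.
Let den (x : E) : R := spread x + least s x ^+ 2.

Let spread_ge0 x : 0 <= spread x.
Proof. by rewrite addr_ge0 ?sqr_ge0// sumr_ge0// => i _; exact: sqr_ge0. Qed.

Let den_gt0 x : 0 < den x.
Proof.
rewrite lt_def addr_ge0 ?sqr_ge0// andbT; apply/negP.
rewrite paddr_eq0 ?sqr_ge0// sqrf_eq0 => /andP[].
rewrite paddr_eq0 ?sqr_ge0//; last by apply: sumr_ge0 => i _; exact: sqr_ge0.
rewrite psumr_eq0 => [/andP[/allP z0]|i _]; last exact: sqr_ge0.
rewrite sqrf_eq0 subr_eq0 => /eqP x1 /eqP l0.
have xE i : x (e i) = x (e 0).
  by have /(_ (mem_index_enum _)) := z0 i; rewrite sqrf_eq0 subr_eq0 => /eqP.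
have x0 : 0 < x (e 0).
  move: x1; rewrite (eq_bigr (fun=> x (e 0)))// sumr_const card_ord => x1.
  by rewrite -(pmulrn_lgt0 _ (ltn0Sn k)) -x1 ltr01.
have : 0 < least s x.
  by apply: least_gt0 => v /finset.imsetP[i _ ->]; rewrite xE.
by rewrite l0 ltxx.
Qed.

Let quot (x : E) : 'rV[R]_k.+1 := \row_i
  if i == 0 then (spread x - least s x ^+ 2) / den x
  else 2 * least s x * slope x i / den x.

Lemma sum_vertices (x : E) : support x = s -> \sum_v x v = \sum_i x (e i).
Proof.
move=> xs; rewrite (bigID (mem s)) /= [X in _ + X]big1 => [|v]; last first.
  by rewrite -xs inE negbK => /eqP.
rewrite addr0 big_imset /=; last by move=> i j _ _ /e_inj.
by apply: eq_bigl => i; rewrite inE.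
Qed.

Let support_maximal x : polyhedron (simplices K) x -> least s x != 0 ->
  support x = s.
Proof.
move=> [x0 x1 Kx] l0; apply: smax => //; apply: contraNT l0 => sx.
by rewrite least_eq0.
Qed.

Let spread_interior x : polyhedron (simplices K) x -> least s x != 0 ->
  spread x = \sum_i slope x i ^+ 2.
Proof.
move=> Px l0; have [_ x1 _] := Px.
by rewrite /spread -sum_vertices ?x1 ?subrr ?expr0n ?addr0//; exact: support_maximal.
Qed.

Let quot_sphere x : polyhedron (simplices K) x -> quot x \in @sphere_set R k.
Proof.
move=> Px; apply/mem_set; rewrite /sphere_set /=.
have den0 : den x != 0 by rewrite gt_eqF.
have [l0|l0] := eqVneq (least s x) 0.
  rewrite (bigD1 0) //= big1 => [|i /negPf i0]; last first.
    by rewrite mxE i0 l0 mulr0 !mul0r expr0n.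
  move: den0; rewrite mxE eqxx /den l0 expr0n subr0 /= addr0 => den0.
  by rewrite addr0 divff ?expr1n.
have := spread_interior Px l0; rewrite (bigD1 0) //= /slope subrr expr0n add0r.
rewrite -/slope => sE.
rewrite (bigD1 0) //= mxE eqxx.
rewrite (eq_bigr (fun i => (2 * least s x / den x) ^+ 2 * slope x i ^+ 2)); last first.
  by move=> i /negPf i0; rewrite mxE i0 -exprMn; congr (_ ^+ 2); rewrite mulrAC.
rewrite -mulr_sumr -sE; move: den0; rewrite /den.
by move: (spread x) (least s x) => a m d0; field.
Qed.

Definition simplex_quotient (x : X) : sphere R k :=
  exist _ (quot (val x)) (quot_sphere (coordinates_polyhedron x)).

Lemma simplex_quotient_continuous : continuous simplex_quotient.
Proof.
apply: continuous_into_sub; apply: continuous_into_rV => i.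
rewrite (_ : (fun t => _) = fun x : X =>
  if i == 0 then (spread (val x) - least s (val x) ^+ 2) / den (val x)
  else 2 * least s (val x) * slope (val x) i / den (val x)); last first.
  by apply/funext => x; rewrite /= mxE.
have vc w : continuous (fun x : X => val x w) by exact: point_coordinate_continuous.
have lc : continuous (fun x : X => least s (val x)).
  exact: (continuous_funcomp (@initial_continuous _ _ set_val) (@least_continuous _ _ s)).
have sqc (f : X -> R) : continuous f -> continuous (fun y => f y ^+ 2).
  by move=> fc; exact: continuous_mul.
have slc i' : continuous (fun x : X => slope (val x) i').
  by apply: continuous_add => //; exact: continuous_opp.
have spc : continuous (fun x : X => spread (val x)).
  apply: continuous_add.
    by apply: continuous_sumr => i'; exact: sqc.
  apply: sqc; apply: continuous_add; first exact: continuous_const.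
  by apply: continuous_opp; exact: continuous_sumr.
have dc : continuous (fun x : X => den (val x)).
  by apply: continuous_add => //; exact: sqc.
have d0 (x : X) : den (val x) != 0 by rewrite gt_eqF.
case: (i == 0); apply: continuous_div => //.
  by apply: continuous_add => //; apply: continuous_opp; exact: sqc.
apply: continuous_mul => //; apply: continuous_mul => //.
exact: continuous_const.
Qed.

Lemma simplex_quotient_base (x : X) :
  support (val x) != s -> simplex_quotient x = point.
Proof.
move=> xs; have Px := coordinates_polyhedron x.
have l0 : least s (val x) = 0.
  by apply/eqP; apply: contraNT xs => l0; exact/eqP/support_maximal.
apply/val_inj/rowP => i /=; rewrite !mxE eqxx /=.
have d0 : den (val x) != 0 by rewrite gt_eqF.
case: ifPn => [i0|/negPf i0]; last by rewrite l0 mulr0 !mul0r.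
by move: d0; rewrite /den l0 expr0n subr0 addr0 => d0; rewrite divff.
Qed.

Let least_interior (x : X) : support (val x) = s -> 0 < least s (val x).
Proof.
move=> xs; apply: least_gt0 => v vs.
have [x0 _ _] := coordinates_polyhedron x.
by apply: (support_gt0 x0 _ vs); rewrite xs.
Qed.

Lemma simplex_quotient_interior (x : X) :
  support (val x) = s -> simplex_quotient x <> point.
Proof.
move=> xs /(congr1 (fun z : sphere R k => val z 0 0)); have := least_interior xs.
rewrite /= !mxE eqxx /=; have := den_gt0 (val x); rewrite /den.
move: (spread _) (least _ _) => a m d0 m0.
rewrite -[RHS](divff (lt0r_neq0 d0)) => /(mulIf _)/eqP.
rewrite invr_eq0 lt0r_neq0// => /(_ isT)/eqP; nra.
Qed.

Let quot_ratio (x : X) i : support (val x) = s ->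
  let q := val (simplex_quotient x) in
  i != 0 -> slope (val x) i = least s (val x) * (q 0 i / (1 - q 0 0)).
Proof.
move=> xs /= /negPf i0; rewrite !mxE i0 eqxx.
have l0 : least s (val x) != 0 by rewrite lt0r_neq0// least_interior.
move: (den_gt0 (val x)) l0; rewrite /den.
move: (spread _) (least _ _) (slope _ _) => a m z d0 m0.
have d0' : a + m ^+ 2 != 0 by rewrite gt_eqF.
have -> : 1 - (a - m ^+ 2) / (a + m ^+ 2) = 2 * m ^+ 2 / (a + m ^+ 2) by field.
by field; rewrite d0' m0.
Qed.

(** The image determines the slopes divided by the least coordinate, hence all the
    coordinates divided by the least one up to a common additive constant; the
    constant is 0 since the smallest of these ratios is 1 for both points, and
    the total mass 1 then determines the least coordinate. *)
Lemma simplex_quotient_inj (x y : X) :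
  support (val x) = s -> support (val y) = s ->
  simplex_quotient x = simplex_quotient y -> x = y.
Proof.
move=> xs ys qxy.
have [x0 x1 _] := coordinates_polyhedron x.
have [y0 y1 _] := coordinates_polyhedron y.
have sn0 : s != finset.set0 by apply/finset.set0Pn; exists (e 0).
have mx0 := least_interior xs; have my0 := least_interior ys.
have [_ /finset.imsetP[i _ ->] lxi] := least_attained x0 x1 sn0.
have [_ /finset.imsetP[j _ ->] lyj] := least_attained y0 y1 sn0.
have slE i' : slope (val x) i' * least s (val y) = slope (val y) i' * least s (val x).
  have [->|i0] := eqVneq i' 0; first by rewrite /slope !subrr !mul0r.
  by rewrite !quot_ratio// qxy; ring.
have dE a b : (val x (e a) - val x (e b)) * least s (val y) =
              (val y (e a) - val y (e b)) * least s (val x).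
  by have := slE a; have := slE b; rewrite /slope; lra.
have lex a : least s (val x) <= val x (e a) by exact: least_le.
have ley a : least s (val y) <= val y (e a) by exact: least_le.
have prop a : val x (e a) * least s (val y) = val y (e a) * least s (val x).
  have := dE a i; have := dE i j; have := lex j; have := ley i; rewrite -lxi -lyj.
  move: (least _ (val x)) (least _ (val y)) mx0 my0 => m n m0 n0; nra.
have mE : least s (val x) = least s (val y).
  have : \sum_i val x (e i) * least s (val y) = \sum_i val y (e i) * least s (val x).
    by apply: eq_bigr => a _.
  by rewrite -!mulr_suml -!sum_vertices// x1 y1 !mul1r.
apply/val_inj/funext => v; have [vs|vs] := boolP (v \in s); last first.
  have : v \notin support (val x) by rewrite xs.
  have : v \notin support (val y) by rewrite ys.
  by rewrite !inE !negbK => /eqP -> /eqP.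
have /finset.imsetP[a _ ->] := vs.
by apply: (mulIf (lt0r_neq0 my0)); rewrite prop mE.
Qed.

(** The preimage inverts the stereographic projection, shifts the slopes so that
    the least coordinate becomes 1, and rescales the total mass to 1. *)
Lemma simplex_quotient_surj (z : sphere R k) : z != point ->
  exists2 x : X, support (val x) = s & simplex_quotient x = z.
Proof.
move=> zp; pose c i := val z 0 i.
have c1 : c 0 ^+ 2 + \sum_(i < k.+1 | i != 0) c i ^+ 2 = 1.
  by have := set_mem (valP z); rewrite /sphere_set /= (bigD1 0).
have cge : 0 <= \sum_(i < k.+1 | i != 0) c i ^+ 2.
  by apply: sumr_ge0 => i _; exact: sqr_ge0.
have c0 : c 0 < 1.
  rewrite ltNge; apply: contra zp => c0; apply/eqP.
  have S0 : \sum_(i < k.+1 | i != 0) c i ^+ 2 = 0 by nra.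
  have c01 : c 0 = 1 by nra.
  have {S0} ci i : i != 0 -> c i = 0.
    move=> i0; move: S0 => /eqP; rewrite psumr_eq0 => [/allP|? _]; last exact: sqr_ge0.
    by move=> /(_ i (mem_index_enum _)); rewrite i0 sqrf_eq0 => /eqP.
  apply/val_inj/rowP => i; rewrite /= mxE eqxx /=.
  by have [->|/[dup]/ci ci0 /negPf i0] := eqVneq i 0; rewrite -/(c _) ?c01 ?ci0.
pose Z i := if i == 0 then 0 else c i / (1 - c 0).
have [i0 _ Zmin] := @arg_minP _ _ _ (0 : 'I_k.+1) xpredT Z isT.
pose rho i := Z i - Z i0 + 1.
have rho1 i : 1 <= rho i by rewrite lerDr subr_ge0 Zmin.
pose T := \sum_i rho i.
have T1 : 1 <= T.
  rewrite /T (bigD1 0) //= -[leLHS]addr0 lerD// sumr_ge0// => i _.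
  exact: le_trans ler01 _.
have T0 : 0 < T by exact: lt_le_trans ltr01 _.
pose x : E := fun v => \sum_i rho i / T * (v == e i)%:R.
have xe i : x (e i) = rho i / T.
  rewrite /x (bigD1 i) //= eqxx mulr1 big1 ?addr0// => j /negPf ji.
  by rewrite (inj_eq e_inj) eq_sym ji mulr0.
have xs v : v \notin s -> x v = 0.
  move=> vs; rewrite /x big1// => i _; suff /negPf -> : v != e i by rewrite mulr0.
  by apply: contra vs => /eqP ->.
have xsup : support x = s.
  apply/finset.setP => v; rewrite inE; have [vs|/xs ->] := boolP (v \in s).
    have /finset.imsetP[i _ ->] := vs.
    by rewrite xe gt_eqF// divr_gt0// (lt_le_trans ltr01).
  by rewrite eqxx.
have xP : polyhedron (simplices K) x.
  split=> [v||]; last by rewrite xsup.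
  - by apply: sumr_ge0 => i _; rewrite mulr_ge0// divr_ge0 ?(ltW T0)// (le_trans ler01).
  - by rewrite sum_vertices// (eq_bigr _ (fun i _ => xe i)) -mulr_suml divff// gt_eqF.
have [x0 x1 _] := xP.
have lx : least s x = T^-1.
  apply/eqP; rewrite eq_le; apply/andP; split.
    by rewrite (le_trans (least_le x (es i0)))// xe /rho subrr add0r mul1r.
  have [|_ /finset.imsetP[i _ ->] ->] := @least_attained _ _ s x x0 x1.
    by apply/finset.set0Pn; exists (e 0).
  by rewrite xe ler_pMl ?invr_gt0.
have slx i : slope x i = Z i / T.
  by rewrite /slope !xe -mulrBl /rho; congr (_ / _); rewrite {3}/Z eqxx; ring.
have [a0 t0] : 1 - c 0 != 0 /\ T != 0 by rewrite subr_eq0 !gt_eqF.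
have spx : spread x = (1 + c 0) / (1 - c 0) / T ^+ 2.
  have lx0 : least s x != 0 by rewrite lx invr_eq0 gt_eqF.
  rewrite (spread_interior xP lx0) (bigD1 0) //= slx /Z eqxx mul0r expr0n add0r.
  rewrite (eq_bigr (fun i => c i ^+ 2 * ((1 - c 0) * T) ^- 2)) => [|i /negPf i1].
    rewrite -mulr_suml (_ : \sum_(_ < _ | _) _ = 1 - c 0 ^+ 2); last by lra.
    by field; rewrite a0 t0.
  by rewrite slx /Z i1; field; rewrite a0 t0.
exists (exist _ x (mem_set xP)) => //.
apply/val_inj/rowP => i; rewrite /= mxE /den spx lx slx /Z -/(c i).
have d2 : 1 + c 0 + (1 - c 0) != 0.
  by rewrite (_ : _ + _ = 2) ?pnatr_eq0//; ring.
by have [->|i1] := eqVneq i 0; field; rewrite a0 t0.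
Qed.
End SphereQuotient.

(** * Complexes that are bouquets of spheres up to homotopy *)

Section Bouquets.
Variable R : realType.

(** For a compact Hausdorff [W] and a finite [I] this says that [W] is the wedge
    of the spheres of dimensions [dim i].  Unlike an iterated wedge it does not
    remember how the spheres are grouped, and it can be reindexed freely. *)
Definition bouquet (W : topologicalType) (w0 : W) (I : Type) (dim : I -> nat) :=
  exists j : forall i, sphere R (dim i) -> W,
  [/\ forall i, continuous (j i) /\ injective (j i),
      forall i, j i point = w0,
      forall i i' z z', i <> i' -> j i z = j i' z' -> j i z = w0 &
      forall w, w = w0 \/ exists i z, w = j i z].

Section RealizationBouquet.
Variables (V : finType) (K : scomplex V) (I : finType) (cell : I -> {set V}).
Variables (dim : I -> nat) (v0 : V).
Hypothesis cell_inj : injective cell.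
Hypothesis cellK : forall i, simplices K (cell i).
Hypothesis cell_max : forall i (t : {set V}),
  simplices K t -> cell i \subset t -> t = cell i.
Hypothesis cell_card : forall i, #|cell i| = (dim i).+1.
Hypothesis Kv0 : simplices K [set v0]%SET.
Hypothesis v0_cell : forall i, cell i != [set v0]%SET.
Hypothesis contract :
  deform (polyhedron (R := R)
            (fun s => simplices K s /\ s \notin (cell @: [set: I])%SET))
         (polyhedron (fun s => s \subset [set v0]%SET)).
Local Notation X := (realization R K).

(** Collapsing the contractible complex of the non-cells identifies the boundary
    of each cell to a point, and the quotient map is assembled from the maps
    [simplex_quotient]. *)
Lemma realization_bouquet (W : topologicalType) (w0 : W) :
  hausdorff_space W -> bouquet w0 dim ->
  homotopy_equivalent R X W.
Proof.
move=> hW [j [/all_and2[jc jI] jp jN jS]].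
pose e i (a : 'I_(dim i).+1) : V := enum_val (cast_ord (esym (cell_card i)) a).
have e_inj i : injective (e i) by move=> a b /enum_val_inj/cast_ord_inj.
have eE i : (e i @: [set: 'I_(dim i).+1])%SET = cell i.
  apply/finset.setP => v; apply/finset.imsetP/idP => [[a _ ->]|vi].
    exact: enum_valP.
  exists (cast_ord (cell_card i) (enum_rank_in vi v)) => //.
  by rewrite /e cast_ordK enum_rankK_in.
have eK i : simplices K (e i @: [set: 'I_(dim i).+1])%SET by rewrite eE.
have emax i (t : {set V}) : simplices K t ->
    (e i @: [set: 'I_(dim i).+1])%SET \subset t ->
    t = (e i @: [set: 'I_(dim i).+1])%SET.
  by rewrite eE; exact: cell_max.
pose q i : X -> sphere R (dim i) := simplex_quotient (e_inj i) (emax i).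
pose f (x : X) : W :=
  if [pick i | cell i == support (val x)] is Some i then j i (q i x) else w0.
pose M := (cell @: [set: I])%SET.
have fcell i (x : X) : support (val x) = cell i -> f x = j i (q i x).
  move=> xi; rewrite /f; case: pickP => [i' /eqP|/(_ i)]; last by rewrite xi eqxx.
  by rewrite xi => /cell_inj ->.
have fM (x : X) : support (val x) \notin M -> f x = w0.
  move=> xM; rewrite /f; case: pickP => // i /eqP xi.
  by case/negP: xM; rewrite -xi; apply/finset.imsetP; exists i.
have inM (x : X) : support (val x) \in M -> exists i, support (val x) = cell i.
  by move=> /finset.imsetP[i _ xi]; exists i.
have qbase i (x : X) : support (val x) <> cell i -> j i (q i x) = w0.
  move=> xi; rewrite /q simplex_quotient_base ?jp//.
  by rewrite eE; exact/eqP.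
have jqc i : continuous (fun x => j i (q i x)).
  apply: (continuous_funcomp _ (jc i)).
  exact: simplex_quotient_continuous.
have jq0 i (x : X) : support (val x) = cell i -> j i (q i x) <> w0.
  by rewrite -(jp i) => xi /jI; apply: simplex_quotient_interior; rewrite eE.
(* All the maps j i (q i x) but at most one take the value w0 at x: so f x lies in
   a set C iff all of them do, if w0 is in C, and iff one of them does, if not. *)
have fc : continuous f.
  apply/continuous_closedP => C cC; have [Cw0|Cw0] := pselect (C w0).
    rewrite (_ : f @^-1` C =
        \bigcap_(i in [set: I]) ((fun x => j i (q i x)) @^-1` C)).
      apply: closed_bigI => i _.
      by have /continuous_closedP/(_ C cC) := jqc i.
    apply/seteqP; split=> x /=.
      move=> Cx i _ /=; have [xi|xi] := pselect (support (val x) = cell i).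
        by rewrite -fcell.
      by rewrite qbase.
    move=> Cx; have [/inM[i xi]|/fM ->//] := boolP (support (val x) \in M).
    by rewrite (fcell i)//; exact: Cx.
  rewrite (_ : f @^-1` C =
      \bigcup_(i in [set: I]) ((fun x => j i (q i x)) @^-1` C)).
    apply: closed_bigcup => [|i _]; first exact: finite_finset.
    by have /continuous_closedP/(_ C cC) := jqc i.
  apply/seteqP; split=> x /=.
    have [/inM[i xi] Cx|/fM -> //] := boolP (support (val x) \in M).
    by exists i => //=; rewrite -fcell.
  move=> [i _ /= Cx]; rewrite (fcell i)//; apply: contrapT => xi.
  by apply: Cw0; rewrite -(qbase i x xi).
have Mmax (s t : {set V}) : s \in M -> simplices K t -> s \subset t -> t = s.
  by move=> /finset.imsetP[i _ ->]; exact: cell_max.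
have M0 : finset.set0 \notin M.
  apply/negP => /finset.imsetP[i _ i0].
  by have := cell_card i; rewrite -i0 cards0.
have v0M : [set v0]%SET \notin M.
  by apply/negP => /finset.imsetP[i _ /esym/eqP]; rewrite (negPf (v0_cell i)).
have [h [x0 ph]] := extend_contraction Mmax M0 Kv0 v0M contract.
have [xv xvE] := vertex_point R Kv0.
apply: (collapse_homotopy_equivalent (f := f) _ hW fc _ _ _ ph).
- exact: realization_compact.
- move=> w; case: (jS w) => [->|[i [z ->]]].
    by exists xv; apply: fM; rewrite xvE.
  have [->|zp] := eqVneq z point.
    by rewrite jp; exists xv; apply: fM; rewrite xvE.
  have [x xE qx] := simplex_quotient_surj (e_inj i) (eK i) (emax i) zp.
  by exists x; rewrite (fcell i) ?xE ?eE// /q qx.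
- move=> x y fxy.
  have [/inM[i xi]|xM] := boolP (support (val x) \in M); last first.
    have [/inM[i yi]|yM] := boolP (support (val y) \in M); last by right.
    by case: (jq0 i y yi); rewrite -fcell// -fxy fM.
  have [/inM[i' yi]|yM] := boolP (support (val y) \in M); last first.
    by case: (jq0 i x xi); rewrite -fcell// fxy fM.
  left; move: fxy; rewrite (fcell i)// (fcell i')//.
  have [ii|ii] := pselect (i = i'); last first.
    by move=> jxy; case: (jq0 i x xi); exact: jN ii jxy.
  by rewrite -ii in yi *; move=> /jI; apply: simplex_quotient_inj; rewrite eE.
- by move=> x y /fM -> /fM ->.
Qed.
End RealizationBouquet.
End Bouquets.

(** * Wedges of spheres are bouquets *)

Section WedgeLift.
Variables (I : choiceType) (X : I -> topologicalType) (p0 : forall i, X i).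

Let wedge_prod_lift i (x : X i) :
  wedge_prod (wedge_lift p0 x) = dfwith p0 i x.
Proof. exact/wedge_lift_funE/wedge_prod_pointE. Qed.

Lemma wedge_lift_inj i : injective (@wedge_lift _ _ p0 i).
Proof.
move=> x y /(congr1 (fun w => wedge_prod w i)).
by rewrite !wedge_prod_lift !dfwithin.
Qed.

Lemma wedge_lift_disjoint i j (x : X i) (y : X j) :
  i <> j -> wedge_lift p0 x = wedge_lift p0 y -> x = p0 i.
Proof.
move=> ij /(congr1 (fun w => wedge_prod w i)).
by rewrite !wedge_prod_lift dfwithin dfwithout//; apply/eqP => /esym.
Qed.

Lemma wedge_lift_surj w : exists i (x : X i), w = wedge_lift p0 x.
Proof.
by have : [set: wedge p0] w by []; rewrite -wedgeTE => -[i _ [x _ <-]]; exists i, x.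
Qed.
End WedgeLift.

Lemma pwedge_lift_point (I : pointedType) (X : I -> ptopologicalType) i :
  wedge_lift (fun i => @point (X i)) (@point (X i)) = point :> pwedge X.
Proof. by apply: wedge_liftE; exact: point. Qed.

Section WedgesOfSpheres.
Variable R : realType.

Lemma sphere_hausdorff k : hausdorff_space (sphere R k).
Proof. exact/hausdorff_sub/norm_hausdorff. Qed.

Lemma wedge_spheres_hausdorff m k : hausdorff_space (wedge_spheres R m k).
Proof.
apply: wedge_hausdorff => -[i|]; first exact: sphere_hausdorff.
by move=> x y _; case: x; case: y.
Qed.

Lemma wedge2_hausdorff (Y Z : ptopologicalType) :
  hausdorff_space Y -> hausdorff_space Z -> hausdorff_space (wedge2 Y Z).
Proof. by move=> hY hZ; apply: wedge_hausdorff => -[]. Qed.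

Lemma bouquet_reindex (W : topologicalType) (w0 : W) (I J : Type)
    (dim : I -> nat) (phi : J -> I) : injective phi ->
  (forall i, exists a, phi a = i) -> bouquet R w0 dim ->
  bouquet R w0 (dim \o phi).
Proof.
move=> phiI phiS [j [jcI jp jd jS]]; exists (fun a => j (phi a)).
split=> [a|a|a b z z' ab|w]; first exact: jcI.
- exact: jp.
- by apply: jd => /phiI.
have [->|[i [z ->]]] := jS w; first by left.
by right; have [a ai] := phiS i; subst i; exists a, z.
Qed.

Lemma pwedge_bouquet (I : pointedType) (X : I -> ptopologicalType)
    (J : I -> Type) (dim : forall i, J i -> nat) :
  (forall i, bouquet R (@point (X i)) (dim i)) ->
  bouquet R (@point (pwedge X))
    (fun a : {i & J i} => dim (projT1 a) (projT2 a)).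
Proof.
move=> bX; pose j i := projT1 (cid (bX i)); have jP i := projT2 (cid (bX i)).
pose p0 i := @point (X i).
exists (fun a z => @wedge_lift _ X p0 _ (j (projT1 a) (projT2 a) z)); split.
- move=> [i a] /=; have [/(_ a)[jc jI] _ _ _] := jP i; split.
    exact: (continuous_funcomp jc (@wedge_lift_continuous _ X p0 i)).
  by move=> z z' /wedge_lift_inj/jI.
- move=> [i a] /=; have [_ jp _ _] := jP i.
  by have -> : j i a point = point := jp a; exact: pwedge_lift_point.
- move=> [i a] [i' a'] z z' /= aa' jz.
  suff -> : j i a z = point by exact: pwedge_lift_point.
  have [ii'|ii'] := pselect (i = i'); last exact: (wedge_lift_disjoint ii' jz).
  subst i'; have [_ _ jd _] := jP i.
  apply: (jd a a' z z') => [aa|]; first by apply: aa'; rewrite aa.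
  exact: wedge_lift_inj jz.
move=> w; have [i [x ->]] := wedge_lift_surj w; have [_ _ _ jS] := jP i.
have [->|[a [z ->]]] := jS x; first by left; exact: pwedge_lift_point.
by right; exists (existT _ i a), z.
Qed.

Lemma sphere_bouquet k : bouquet R (@point (sphere R k)) (fun _ : unit => k).
Proof.
exists (fun _ => id); split=> // [_|[] []//|w].
  by split=> // x; exact: cvg_id.
by right; exists tt, w.
Qed.

Lemma one_point_bouquet (dim : void -> nat) : bouquet R (@point one_point) dim.
Proof. by exists (fun _ _ => tt); split=> [[]|[]|[]|[]]; left. Qed.

Lemma wedge_spheres_bouquet m k :
  bouquet R (@point (wedge_spheres R m k)) (fun _ : 'I_m => k).
Proof.
pose J (i : option 'I_m) : Type := if i is Some _ then unit else void.
pose phi (i : 'I_m) : {i & J i} := existT J (Some i) tt.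
apply: (@bouquet_reindex _ _ {i & J i} _ (fun=> k) phi).
- by move=> i i' /(congr1 (@projT1 _ _)) [].
- by move=> [[i|] []]; exists i.
- apply: (@pwedge_bouquet _ _ J (fun _ _ => k)) => -[i|].
    exact: sphere_bouquet.
  exact: one_point_bouquet.
Qed.

Lemma wedge2_bouquet (Y Z : ptopologicalType) (I J : Type)
    (dI : I -> nat) (dJ : J -> nat) :
  bouquet R (@point Y) dI -> bouquet R (@point Z) dJ ->
  bouquet R (@point (wedge2 Y Z))
    (fun a : I + J => match a with inl i => dI i | inr i => dJ i end).
Proof.
move=> bY bZ; pose F (b : bool) : Type := if b then I else J.
pose d (b : bool) : F b -> nat := if b return F b -> nat then dI else dJ.
pose phi (a : I + J) : {b & F b} :=
  match a with inl i => existT F true i | inr i => existT F false i end.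
rewrite (_ : (fun _ => _) = (fun a => d (projT1 a) (projT2 a)) \o phi); last first.
  by apply/funext => -[].
apply: bouquet_reindex; last by apply: pwedge_bouquet => -[].
- pose back (t : {b & F b}) : I + J := let: existT b x := t in
    (if b return F b -> I + J then inl else inr) x.
  by apply: (can_inj (g := back)) => -[].
- by move=> [[] i]; [exists (inl i)|exists (inr i)].
Qed.
End WedgesOfSpheres.

(** * Induced forests of a star of cliques *)

Section Forests.
Variable G : sgraph.

(** Every vertex on a cycle has two neighbours on it, and a cycle has more than
    one vertex. *)
Lemma forest_of_one_branching_vertex :
  (forall v w : G, (1 < degree v)%N -> (1 < degree w)%N -> v = w) ->
  is_forest G.
Proof.
move=> one [|x0 [|x1 [|x2 c]]] //= _ /andP[cyc uc].
have deg2 (v a b : G) : edge v a -> edge v b -> a != b -> (1 < degree v)%N.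
  move=> va vb ab; rewrite /degree; apply/card_gt1P; exists a, b.
  by rewrite !inE.
have /and3P[e01 e12 cyc'] :
    [&& edge x0 x1, edge x1 x2 & path (@edge G) x2 (rcons c x0)] by [].
have /and3P[n0 n1 _] := uc.
have [n02 [n12 nx1]] : x0 != x2 /\ x1 != x2 /\ x1 \notin c.
  by move: n0 n1; rewrite !inE !negb_or => /and3P[_ -> _] /andP[-> ->].
have d1 : (1 < degree x1)%N.
  by apply: (@deg2 _ x0 x2) => //; rewrite edge_sym.
have d2 : (1 < degree x2)%N.
  case: c cyc' nx1 {cyc uc n0 n1} => [|y c] /=.
    move=> /andP[e20 _] _; apply: (@deg2 _ x1 x0) => //; first by rewrite edge_sym.
    by apply: contraTneq e01 => ->; rewrite edge_irr.
  move=> /andP[e2y _]; rewrite inE => /norP[n1y _].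
  by apply: (@deg2 _ x1 y) => //; rewrite edge_sym.
by move/eqP: n12; apply; exact: one.
Qed.

Lemma forest_triangle_free (s : {set G}) (x y z : G) :
  is_forest (Defs.induced s) -> x \in s -> y \in s -> z \in s ->
  edge x y -> edge y z -> edge z x -> False.
Proof.
move=> fs xs ys zs xy yz zx.
apply: (fs [:: (exist _ x xs : Defs.induced s); exist _ y ys; exist _ z zs]) => //.
apply/andP; split; first by rewrite /= /induced_edge /= xy yz zx.
have ne (a b : G) : edge a b -> a != b.
  by apply: contraTneq => ->; rewrite edge_irr.
rewrite /= !inE -!val_eqE /= !negb_or (ne _ _ xy) (ne _ _ yz) /=.
by rewrite eq_sym (ne _ _ zx).
Qed.

Lemma degree_induced (s : {set G}) (v : Defs.induced s) :
  degree v = #|[set w in s | edge (val v) w]|.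
Proof.
rewrite /degree -(fintype.card_image val_inj); apply: eq_card => w; rewrite !inE.
apply/fintype.imageP/andP => [[u]|[ws vw]].
  by rewrite inE => vu ->; rewrite (valP u).
by exists (exist _ w ws).
Qed.
End Forests.

Section StarOfCliques.
Variables n r : nat.
Local Notation V := (option 'I_n.+1 * 'I_r.+1)%type.
Local Notation G := (lex_product (star n.+1) (complete r.+1)).
Implicit Types s t : {set V}.
Local Open Scope nat_scope.

Definition block s (o : option 'I_n.+1) : {set V} := [set v in s | v.1 == o]%SET.

(** The combinatorial form of the forest condition with degree bound [d].  If
    there is a single central vertex, it is adjacent to all the others, so its
    degree is [#|s|.-1]. *)
Definition faces (d : nat) : {set {set V}} :=
  [set s : {set V} |
    [forall i, #|block s None| + #|block s (Some i)| <= 2] &&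
    ((#|block s None| == 1) ==> (#|s| <= d.+1))]%SET.

Lemma block_sub s t o : s \subset t -> block s o \subset block t o.
Proof.
move=> /fintype.subsetP st; apply/fintype.subsetP => v; rewrite !inE.
by case/andP => /st -> ->.
Qed.

Lemma block_card_sub s t o : s \subset t -> #|block s o| <= #|block t o|.
Proof. by move=> st; exact/subset_leq_card/block_sub. Qed.

Lemma blocks_disjoint s o o' : o != o' ->
  #|block s o :|: block s o'| = #|block s o| + #|block s o'|.
Proof.
move=> oo'; rewrite finset.cardsU (_ : block s o :&: block s o' = finset.set0)%SET.
  by rewrite cards0 subn0.
apply/finset.setP => v; rewrite !inE.
by case: eqP => [->|]; rewrite ?(negPf oo') !andbF.
Qed.

Lemma card_blocks s : #|s| = #|block s None| + \sum_i #|block s (Some i)|.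
Proof.
rewrite -sum1_card (partition_big fst xpredT) //= (bigD1 None) //=.
congr (_ + _).
  by rewrite -sum1_card; apply: eq_bigl => v; rewrite !inE.
rewrite (reindex_onto Some (fun o => odflt ord0 o)) /=; last by case.
apply: eq_big => [i|i _]; first by rewrite eqxx.
by rewrite -sum1_card; apply: eq_bigl => v; rewrite !inE.
Qed.

Lemma eq_blocks s t : s \subset t ->
  (forall o, #|block t o| <= #|block s o|) -> t = s.
Proof.
move=> st le; apply/eqP; rewrite eq_sym finset.eqEcard st /=.
rewrite (card_blocks t) (card_blocks s).
by rewrite leq_add// leq_sum.
Qed.

Lemma edgeE (u v : G) : edge u v =
  ((u.1 == v.1) && (u.2 != v.2)) || (isSome u.1 (+) isSome v.1).
Proof. by []. Qed.

Lemma edge_clique i (u v : G) : u != v ->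
  (u.1 == None) || (u.1 == Some i) -> (v.1 == None) || (v.1 == Some i) ->
  edge u v.
Proof.
case: u v => [u a] [v b]; rewrite edgeE xpair_eqE /=.
by move=> uv /pred2P[ui|ui] /pred2P[vi|vi]; move: uv; rewrite ui vi ?eqxx //= => ->.
Qed.

(** The central clique and one leaf clique together form a clique, and three
    vertices of a clique form a triangle. *)
Lemma forest_blocks s (i : 'I_n.+1) : forest_simplices (G := G) s ->
  #|block s None| + #|block s (Some i)| <= 2.
Proof.
move=> fs; rewrite -blocks_disjoint// leqNgt; apply/negP => /card_gt2P.
move=> [x [y [z [[xb yb zb] [xy yz zx]]]]].
have bP v : v \in block s None :|: block s (Some i) ->
    v \in s /\ (v.1 == None) || (v.1 == Some i).
  by rewrite !inE -andb_orr => /andP[].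
have [xs xi] := bP x xb; have [ys yi] := bP y yb; have [zs zi] := bP z zb.
by apply: (forest_triangle_free (G := G) fs xs ys zs); exact: (@edge_clique i).
Qed.

Lemma center_neighbours s (v : V) : v \in block s None ->
  #|block s None| = 1 ->
  [set w in s | edge (v : G) w]%SET = s :\ v.
Proof.
rewrite inE => /andP[vs /eqP v0] /eqP/cards1P[u bu].
have bv : block s None = [set v]%SET.
  have : v \in block s None by rewrite inE vs v0 eqxx.
  by rewrite bu inE => /eqP ->.
apply/finset.setP => w; rewrite !inE edgeE v0 /= andbC.
have [ws|] := boolP (w \in s); last by rewrite !andbF.
rewrite !andbT; have [->|wv] := eqVneq w v; first by rewrite v0 !eqxx.
case w0 : w.1 => [j|] //=.
have : w \in block s None by rewrite inE ws w0.
by rewrite bv inE (negPf wv).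
Qed.

(** The neighbours of a leaf vertex lie in its own clique and in the central one;
    those of a central vertex that is not alone lie in the central clique, since
    two central vertices leave no room for leaf vertices. *)
Lemma neighbours_small s (v : V) :
  (forall i, #|block s None| + #|block s (Some i)| <= 2) -> v \in s ->
  ~~ ((v.1 == None) && (#|block s None| == 1)) ->
  #|[set w in s | edge (v : G) w]%SET| <= 1.
Proof.
move=> sb vs vN; have [i [vb sub]] : exists i,
    v \in block s None :|: block s (Some i) /\ [set w in s | edge (v : G) w]%SET
    \subset (block s None :|: block s (Some i)) :\ v.
  case v0 : v.1 vN => [i|] vN.
    exists i; split; first by rewrite !inE v0 vs eqxx orbT.
    apply/fintype.subsetP => w; rewrite !inE edgeE v0 /= => /andP[ws].
    rewrite ws /=; have [->|wv] := eqVneq w v; first by rewrite v0 !eqxx.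
    by case: w.1 => [j|] //=; rewrite orbF => /andP[/eqP -> _].
  have c2 : 1 < #|block s None|.
    by rewrite ltn_neqAle eq_sym vN card_gt0; apply/finset.set0Pn; exists v;
       rewrite inE vs v0.
  exists ord0; split; first by rewrite !inE v0 vs.
  apply/fintype.subsetP => w; rewrite !inE edgeE v0 /= => /andP[ws].
  rewrite ws /=; have [->|wv] := eqVneq w v; first by rewrite v0 !eqxx.
  case w0 : w.1 => [j|] //= _.
  have : 0 < #|block s (Some j)|.
    by rewrite card_gt0; apply/finset.set0Pn; exists w; rewrite inE ws w0 eqxx.
  by move=> bj; have := leq_trans (leq_add c2 bj) (sb j).
apply: leq_trans (subset_leq_card sub) _; rewrite -ltnS -add1n.
have := cardsD1 v (block s None :|: block s (Some i)).
by rewrite vb => <-; rewrite blocks_disjoint.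
Qed.

Lemma facesP d s : s \in faces d ->
  (forall i, #|block s None| + #|block s (Some i)| <= 2) /\
  (#|block s None| = 1 -> #|s| <= d.+1).
Proof.
rewrite inE => /andP[/forallP sb /implyP sd]; split=> // c1.
by apply: sd; rewrite c1.
Qed.

Lemma bounded_forest_faces d s : 0 < d ->
  bounded_forest_simplices (G := G) d s <-> s \in faces d.
Proof.
move=> d0; split.
  move=> [fs ds]; rewrite inE; apply/andP; split.
    by apply/forallP => i; exact: forest_blocks.
  apply/implyP => /eqP c1; have /card_gt0P[v vc] : 0 < #|block s None| by rewrite c1.
  have vs : v \in s by move: vc; rewrite inE => /andP[].
  have := leq_trans (leq_bigmax (exist _ v vs : Defs.induced (G := G) s)) ds.
  by rewrite degree_induced /= center_neighbours// (cardsD1 v s) vs.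
move=> /facesP[sb sd].
have degc (v : Defs.induced (G := G) s) : 1 < degree v ->
    ((val v).1 == None) && (#|block s None| == 1).
  by apply: contraTT => vN; rewrite -leqNgt degree_induced neighbours_small// (valP v).
have degN (v : Defs.induced (G := G) s) : (val v).1 == None -> val v \in block s None.
  by move=> vN; rewrite inE vN (valP v).
split.
  apply: forest_of_one_branching_vertex => v w.
  move=> /degc/andP[/degN vN c1] /degc/andP[/degN wN _].
  apply/val_inj; have /cards1P[u bu] := c1.
  by move: vN wN; rewrite bu !inE => /eqP -> /eqP ->.
apply/bigmax_leqP => v _; have [/degc/andP[/degN vN /eqP c1]|] := ltnP 1 (degree v).
  rewrite degree_induced center_neighbours//; have := sd c1.
  by rewrite (cardsD1 (val v) s) (valP v).
by move=> /leq_trans; exact.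
Qed.

(** If there is a single central vertex then every leaf clique contributes at most
    one vertex, so no degree exceeds the number of leaves. *)
Lemma forest_faces s : forest_simplices (G := G) s <-> s \in faces n.+1.
Proof.
split=> [fs|/(@bounded_forest_faces n.+1 s isT)[]//].
rewrite inE; apply/andP; split.
  by apply/forallP => i; exact: forest_blocks.
apply/implyP => /eqP c1; rewrite card_blocks c1 add1n ltnS.
rewrite -[leqRHS]card_ord -sum1_card; apply: leq_sum => i _.
by have := forest_blocks i fs; rewrite c1 add1n.
Qed.
End StarOfCliques.

(** * An acyclic matching of the faces *)

Section CriticalFaces.
Variables n r d : nat.
Local Notation V := (option 'I_n.+1 * 'I_r.+1)%type.
Implicit Types s t : {set V}.
Local Open Scope nat_scope.

Local Notation faces := (@faces n r d).

Definition zero_vertex (i : 'I_n.+1) : V := (Some i, ord0).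

(** The vertex 0 of the clique [i] can be added without violating the clique
    bound.  This does not depend on which of the vertices 0 are already in [s],
    which is why toggling them preserves [first_light]. *)
Definition light s (i : 'I_n.+1) : bool :=
  #|block s None| + #|block s (Some i) :\ zero_vertex i| <= 1.

Definition first_light s : 'I_n.+1 :=
  odflt ord0 [pick i | light s i && [forall j : 'I_n.+1, light s j ==> (i <= j)]].

Definition pivot s : V := zero_vertex (first_light s).

Lemma first_lightP s : [exists i, light s i] ->
  light s (first_light s) /\ forall j, light s j -> first_light s <= j.
Proof.
move=> /existsP[i0 li0]; rewrite /first_light; case: pickP => [i|no] /=.
  move=> /andP[li /forallP fi]; split=> // j lj.
  exact: (implyP (fi j)).
have [i li imin] := arg_minnP (fun i : 'I_n.+1 => i : nat) li0.
have := no i; rewrite li /=; move/negP; case; apply/forallP => j.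
by apply/implyP => /imin.
Qed.

Lemma block_toggle_None s i :
  block (zero_vertex i |: s) None = block s None.
Proof.
apply/finset.setP => v; rewrite !inE.
by have [->|//] := eqVneq v (zero_vertex i); rewrite !andbF.
Qed.

Lemma block_remove_None s i : block (s :\ zero_vertex i) None = block s None.
Proof.
apply/finset.setP => v; rewrite !inE.
by have [->|//] := eqVneq v (zero_vertex i); rewrite !andbF.
Qed.

Lemma light_toggle s i j : light (zero_vertex i |: s) j = light s j.
Proof.
rewrite /light block_toggle_None; congr (_ + #|pred_of_set _| <= 1).
apply/finset.setP => v; rewrite !inE; have [->|] //= := eqVneq v (zero_vertex i).
have [->|/negPf ij] := eqVneq i j; first by rewrite !eqxx.
by rewrite [Some i == _](inj_eq Some_inj) ij !andbF.
Qed.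

Lemma light_remove s i j : light (s :\ zero_vertex i) j = light s j.
Proof.
have [zs|zs] := boolP (zero_vertex i \in s); last first.
  congr (light _ j); apply/finset.setP => v; rewrite !inE.
  by case: eqP => // ->; rewrite (negPf zs).
by rewrite -(light_toggle _ i) finset.setD1K.
Qed.

Lemma eq_first_light s t : light s =1 light t -> first_light s = first_light t.
Proof.
move=> st; rewrite /first_light; congr odflt; apply: eq_pick => i.
by rewrite st; congr (_ && _); apply: eq_forallb => j; rewrite st.
Qed.

Local Notation toggle := (toggle_at pivot).

Lemma light_toggleE s : light (toggle s) =1 light s.
Proof.
by move=> j; rewrite /toggle_at; case: ifP; rewrite ?light_remove ?light_toggle.
Qed.

Lemma pivot_toggle s : pivot (toggle s) = pivot s.
Proof. by congr zero_vertex; apply/eq_first_light/light_toggleE. Qed.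

Lemma toggleK : involutive toggle.
Proof.
move=> s; rewrite {1}/toggle_at pivot_toggle /toggle_at.
case: (boolP (pivot s \in s)) => ps; rewrite !inE eqxx /=.
  by rewrite finset.setD1K.
by rewrite finset.setU1K.
Qed.

Lemma faces_down s t : t \subset s -> s \in faces -> t \in faces.
Proof.
move=> ts /facesP[sb sd]; rewrite inE; apply/andP; split.
  apply/forallP => i; apply: leq_trans (sb i).
  by rewrite leq_add// block_card_sub.
apply/implyP => /eqP tc.
have [sc|sc] := eqVneq #|block s None| 1.
  by apply: leq_trans (sd sc); exact: subset_leq_card.
have sc2 : 1 < #|block s None|.
  by rewrite ltn_neqAle eq_sym sc -tc block_card_sub.
have tb i : #|block t (Some i)| = 0.
  have := block_card_sub (Some i) ts; have := sb i; move: sc2.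
  by move: #|_| #|_| #|_| => a b c; lia.
by rewrite card_blocks tc big1 ?addn0// => i _; rewrite tb.
Qed.

Lemma add_pivot_face s : s \in faces -> [exists i, light s i] ->
  (#|block s None| = 1 -> #|s| <= d) -> pivot s |: s \in faces.
Proof.
move=> /facesP[sb sd] /first_lightP[li _] sc.
rewrite inE block_toggle_None; apply/andP; split.
  apply/forallP => i; have [->|ij] := eqVneq i (first_light s).
    have -> : block (pivot s |: s) (Some (first_light s)) =
        pivot s |: (block s (Some (first_light s)) :\ pivot s).
      by apply/finset.setP => v; rewrite !inE; case: eqP => //= ->; rewrite eqxx.
    by rewrite cardsU1 !inE eqxx /= addnCA ltnS.
  rewrite (_ : block _ (Some i) = block s (Some i)) //.
  apply/finset.setP => v; rewrite !inE; case: (eqVneq v (pivot s)) => //= ->.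
  by rewrite /= [Some _ == _]eq_sym (inj_eq Some_inj) (negPf ij) andbF.
apply/implyP => /eqP /sc sd'; rewrite cardsU1.
exact: leq_add (leq_b1 _) sd'.
Qed.

Definition matched : {set {set V}} :=
  [set s in faces | [exists i, light s i] && (toggle s \in faces)]%SET.

Definition critical : {set {set V}} := (faces :\: matched)%SET.

Lemma matchedE s : (s \in matched) =
  [&& s \in faces, [exists i, light s i] & toggle s \in faces].
Proof. by rewrite inE. Qed.

Lemma light_le1 s : [exists i, light s i] -> #|block s None| <= 1.
Proof. by move=> /existsP[i]; apply: leq_trans; exact: leq_addr. Qed.

Lemma light_sub s t : t \subset s -> forall i, light s i -> light t i.
Proof.
move=> ts i; apply: leq_trans.
by rewrite leq_add ?block_card_sub// subset_leq_card// finset.setSD// block_sub.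
Qed.

Lemma matched_down s t : t \subset s -> s \in matched -> t \in matched.
Proof.
move=> ts; rewrite !matchedE => /and3P[sF sl sT].
have tF := faces_down ts sF.
have tl : [exists i, light t i].
  by have /existsP[i /(light_sub ts) li] := sl; apply/existsP; exists i.
rewrite tF tl /=; have [->//|tns] := eqVneq t s.
rewrite /toggle_at; case: ifP => [_|_].
  by apply: faces_down tF; exact: finset.subD1set.
apply: add_pivot_face => // tc; rewrite -ltnS.
have pts : t \proper s by rewrite finset.properEneq tns.
apply: leq_trans (proper_card pts) _.
have [_ ->//] := facesP sF.
by apply/eqP; rewrite eqn_leq light_le1//= -tc block_card_sub.
Qed.

Lemma toggle_matched s : s \in matched -> toggle s \in matched.
Proof.
rewrite !matchedE toggleK => /and3P[-> /existsP[i li] ->]; rewrite andbT /=.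
by apply/existsP; exists i; rewrite light_toggleE.
Qed.

Lemma pivot_set0 : pivot finset.set0 = zero_vertex ord0.
Proof.
have l0 : light finset.set0 ord0.
  have b0 o : block finset.set0 o = finset.set0 :> {set V}.
    by apply/finset.setP => v; rewrite !inE.
  by rewrite /light !b0 finset.set0D !cards0.
have /first_lightP[_ /(_ _ l0)] : [exists i, light finset.set0 i].
  by apply/existsP; exists ord0.
by rewrite leqn0 => /eqP f0; congr zero_vertex; exact: val_inj.
Qed.

(** Lexicographic in the number of central vertices, [first_light] and the
    cardinality of the lower face of the pair: from a lower face to a face of
    another pair that contains it, the first of these to change increases. *)
Definition collapse_rank s : nat :=
  (#|block s None| * n.+1 + first_light s) * #|{: V}|.+1 + #|s :\ pivot s|.

Lemma block_toggleE s : block (toggle s) None = block s None.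
Proof.
by rewrite /toggle_at; case: ifP; rewrite ?block_toggle_None ?block_remove_None.
Qed.

Lemma collapse_rank_toggle s : collapse_rank (toggle s) = collapse_rank s.
Proof.
rewrite /collapse_rank block_toggleE pivot_toggle.
have -> : first_light (toggle s) = first_light s.
  exact/eq_first_light/light_toggleE.
congr (_ + #|pred_of_set _|); apply/finset.setP => v.
by rewrite /toggle_at; case: ifP; rewrite !inE; case: eqP.
Qed.

Lemma collapse_rank_lt s t : s \in matched -> t \in matched ->
  pivot s \notin s -> s \subset t -> t != s -> t != pivot s |: s ->
  collapse_rank s < collapse_rank t.
Proof.
rewrite !matchedE => /and3P[sF sl sT] /and3P[tF tl tT] ps st ts tps.
have small u : #|u :\ pivot u| < #|{: V}|.+1 by rewrite ltnS max_card.
have lex a b x y : a < b -> x < #|{: V}|.+1 ->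
    a * #|{: V}|.+1 + x < b * #|{: V}|.+1 + y.
  move=> ab xN; apply: leq_trans (leq_addr _ _).
  by apply: leq_trans (leq_mul ab (leqnn _)); rewrite mulSn addnC ltn_add2r.
have [_ fs] := first_lightP sl; have [lt _] := first_lightP tl.
have fst : first_light s <= first_light t by apply/fs/(light_sub st).
have := block_card_sub None st; rewrite leq_eqVlt => /orP[/eqP c|c]; last first.
  apply: lex => //; apply: leq_trans (leq_addr _ _).
  by apply: leq_trans (leq_mul c (leqnn _)); rewrite mulSn addnC ltn_add2r.
move: fst; rewrite leq_eqVlt => /orP[/eqP/val_inj f|f]; last first.
  by apply: lex => //; rewrite c ltn_add2l.
rewrite /collapse_rank c f ltn_add2l /pivot -f -/(pivot s).
have -> : s :\ pivot s = s.
  by apply/finset.setP => v; rewrite !inE; case: eqP => // ->; rewrite (negPf ps).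
rewrite proper_card// finset.properEneq; apply/andP; split; last first.
  by apply/fintype.subsetP => v vs; rewrite !inE (fintype.subsetP st v vs) andbT;
     apply: contraNneq ps => <-.
have [pt|pt] := boolP (pivot s \in t).
  by apply: contraNneq tps => sE; rewrite {2}sE finset.setD1K.
apply: contraNneq ts => sE; rewrite [X in _ == X]sE; apply/eqP/finset.setP => v.
by rewrite !inE; case: eqP => // ->; rewrite (negPf pt).
Qed.

Hypothesis d_gt0 : 0 < d.

(** If no clique is light, then the clique bounds of [s] are all equalities and
    leave no room for further vertices; otherwise only the bound on the degree of
    the unique central vertex prevents toggling, so it is attained. *)
Lemma critical_maximal s t : s \in critical -> t \in faces -> s \subset t -> t = s.
Proof.
rewrite finset.in_setD matchedE => /andP[+ sF]; rewrite sF /= => sM tF st.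
have [tb td] := facesP tF.
have [sl|sl] := boolP [exists i, light s i]; last first.
  have sb i : 1 < #|block s None| + #|block s (Some i)|.
    move: sl; rewrite negb_exists => /forallP/(_ i); rewrite -ltnNge.
    move=> /leq_trans; apply; rewrite leq_add2l subset_leq_card//.
    exact: finset.subD1set.
  apply: eq_blocks => // -[i|]; last first.
    have := sb ord0; have := tb ord0; have := block_card_sub (Some ord0) st.
    by move: #|_| #|_| #|_| #|_| => a b c e; lia.
  have := sb i; have := tb i; have := block_card_sub None st.
  by move: #|_| #|_| #|_| #|_| => a b c e; lia.
move: sM; rewrite sl /= /toggle_at; case: ifP => ps.
  by rewrite (faces_down _ sF)// finset.subD1set.
move=> psF.
have [c1 sd] : #|block s None| = 1 /\ d < #|s|.
  have [c1|c1] := eqVneq #|block s None| 1; last first.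
    by case/negP: psF; apply: add_pivot_face => // /eqP; rewrite (negPf c1).
  split=> //; rewrite ltnNge; apply: contra psF => sd.
  exact: add_pivot_face.
have tc1 : #|block t None| = 1.
  apply/eqP; rewrite eqn_leq -{2}c1 block_card_sub// andbT leqNgt.
  apply/negP => c2; have : \sum_i #|block s (Some i)| = 0.
    apply: big1 => i _; have := block_card_sub (Some i) st; have := tb i.
    by move: c2; move: #|_| #|_| #|_| => a b c; lia.
  by move: sd; rewrite card_blocks c1 => + s0; rewrite s0 addn0 ltnNge d_gt0.
apply/eqP; rewrite eq_sym finset.eqEcard st /=; exact: leq_trans (td tc1) sd.
Qed.
End CriticalFaces.

(** * The critical faces *)

Section CriticalCells.
Variables n r d : nat.
Local Notation V := (option 'I_n.+1 * 'I_r.+1)%type.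
Implicit Types s t : {set V}.
Local Open Scope nat_scope.
Hypothesis d_gt0 : 0 < d.
Hypothesis d_le : d <= n.+1.

Local Notation faces := (@faces n r d).
Local Notation matched := (@matched n r d).
Local Notation critical := (@critical n r d).
Local Notation zero_vertex := (@zero_vertex n r).
Local Notation pivot := (@pivot n r).
Local Notation toggle := (toggle_at pivot).

Lemma zero_vertex_matched : [set zero_vertex ord0]%SET \in matched.
Proof.
have s0F : finset.set0 \in faces.
  rewrite inE; apply/andP; split; last by rewrite cards0 implybT.
  apply/forallP => i; have b0 o : block finset.set0 o = finset.set0 :> {set V}.
    by apply/finset.setP => v; rewrite !inE.
  by rewrite !b0 cards0.
have l0 : [exists i, light (finset.set0 : {set V}) i].
  apply/existsP; exists ord0; rewrite /light.
  have b0 o : block finset.set0 o = finset.set0 :> {set V}.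
    by apply/finset.setP => v; rewrite !inE.
  by rewrite !b0 finset.set0D !cards0.
have t0 : toggle finset.set0 = [set zero_vertex ord0]%SET.
  by rewrite /toggle_at inE pivot_set0 finset.setU0.
rewrite -t0; apply: toggle_matched; rewrite matchedE s0F l0.
rewrite /toggle_at finset.in_set0 /=.
by apply: add_pivot_face => // _; rewrite cards0.
Qed.

Lemma faces_homotopy_equivalent (R : realType) (K : scomplex V)
    (W : topologicalType) (w0 : W) (I : finType) (dim : I -> nat)
    (cell : I -> {set V}) :
  (forall s, simplices K s <-> s \in faces) ->
  hausdorff_space W -> bouquet R w0 dim ->
  injective cell -> (forall s, s \in critical <-> exists i, s = cell i) ->
  (forall i, #|cell i| = (dim i).+1) ->
  homotopy_equivalent R (realization R K) W.
Proof.
move=> KF hW bW cellI cellP cellc.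
have crit i : cell i \in critical by apply/cellP; exists i.
have critF s : s \in critical -> s \in faces by rewrite finset.in_setD => /andP[].
have critM s : s \in critical -> s \notin matched by rewrite finset.in_setD => /andP[].
have v0M := zero_vertex_matched.
have cells : (cell @: [set: I])%SET = critical.
  apply/finset.setP => s; apply/finset.imsetP/idP => [[i _ ->]//|/cellP[i ->]].
  by exists i.
apply: (@realization_bouquet R V K I cell dim (zero_vertex ord0)) hW bW => //.
- by move=> i; apply/KF/critF.
- by move=> i t /KF tF; exact: critical_maximal (crit i) tF.
- by apply/KF; move: v0M; rewrite matchedE => /and3P[].
- by move=> i; apply: contraTneq (crit i) => ->; apply: contraL v0M => /critM.
rewrite (_ : (fun s => _) = fun s => is_true (s \in matched)); last first.
  apply/funext => s; rewrite cells; apply/propext; split.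
    by move=> [/KF sF]; rewrite finset.in_setD sF andbT negbK.
  move=> sM; split; last by rewrite finset.in_setD sM.
  by apply/KF; move: sM; rewrite matchedE => /and3P[].
apply: (@deform_matched _ _ pivot (@collapse_rank n r)).
- by move=> s t; exact: matched_down.
- exact: pivot_set0.
- by move=> s sM; rewrite toggle_matched// pivot_toggle collapse_rank_toggle.
- by move=> s t; exact: collapse_rank_lt.
Qed.

Lemma critical_dark s : s \in critical -> #|block s None| != 1 ->
  forall i, 1 < #|block s None| + #|block s (Some i) :\ zero_vertex i|.
Proof.
rewrite finset.in_setD matchedE => /andP[+ sF]; rewrite sF /= => sM c1 i.
rewrite ltnNge; apply: contra sM => li.
have sl : [exists i, light s i] by apply/existsP; exists i.
rewrite sl /= /toggle_at; case: ifP => _.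
  by rewrite (faces_down _ sF)// finset.subD1set.
by apply: add_pivot_face => // /eqP; rewrite (negPf c1).
Qed.

Lemma dark_critical s : s \in faces ->
  (forall i, 1 < #|block s None| + #|block s (Some i) :\ zero_vertex i|) ->
  s \in critical.
Proof.
move=> sF dark; rewrite finset.in_setD sF andbT matchedE sF /= negb_and.
by rewrite negb_exists; apply/orP; left; apply/forallP => i; rewrite -ltnNge.
Qed.

Definition critical_with_centre k : {set {set V}} :=
  [set s in critical | #|block s None| == k]%SET.

Lemma critical_with_centreP k s : s \in critical_with_centre k ->
  [/\ s \in critical, s \in faces & #|block s None| = k].
Proof.
rewrite inE => /andP[sC /eqP sk]; split=> //.
by move: sC; rewrite finset.in_setD => /andP[].
Qed.

Lemma card_critical0 s : s \in critical_with_centre 0 -> #|s| = 2 * n.+1.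
Proof.
move=> /critical_with_centreP[sC /facesP[sb _] s0].
rewrite card_blocks s0 add0n (eq_bigr (fun=> 2)).
  by rewrite sum_nat_const card_ord mulnC.
move=> i _; apply/eqP; rewrite eqn_leq; have := sb i; rewrite s0 add0n => -> /=.
have := critical_dark sC; rewrite s0 => /(_ isT i); rewrite add0n => /leq_trans; apply.
exact/subset_leq_card/finset.subD1set.
Qed.

(** Either toggling is prevented by the degree bound only, which is then attained,
    or every leaf clique has a vertex, and then
    [n.+2 <= #|s| <= d.+1 <= n.+2]. *)
Lemma card_critical1 s : s \in critical_with_centre 1 -> #|s| = d.+1.
Proof.
move=> /critical_with_centreP[sC sF s1]; have [sb sd] := facesP sF.
apply/eqP; rewrite eqn_leq sd//=; move: sC.
rewrite finset.in_setD matchedE sF /= andbT.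
have [sl|sl _] := boolP [exists i, light s i]; last first.
  rewrite card_blocks s1 add1n ltnS (leq_trans d_le)//.
  rewrite -[leqLHS]card_ord -sum1_card; apply: leq_sum => i _.
  move: sl; rewrite negb_exists => /forallP/(_ i).
  rewrite /light s1 add1n -ltnNge ltnS => /leq_trans; apply.
  exact/subset_leq_card/finset.subD1set.
rewrite /toggle_at; case: ifP => _.
  by rewrite (faces_down _ sF)// finset.subD1set.
by rewrite ltnNge; apply: contra => sd'; exact: add_pivot_face.
Qed.

Lemma card_critical2 s : s \in critical_with_centre 2 -> #|s| = 2.
Proof.
move=> /critical_with_centreP[_ /facesP[sb _] s2].
rewrite card_blocks s2 big1 ?addn0// => i _; apply/eqP.
by have := sb i; rewrite s2 -leqn0 -{2}[2]addn0 leq_add2l.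
Qed.

Lemma critical_centres s : s \in critical ->
  exists2 k : nat, k <= 2 & s \in critical_with_centre k.
Proof.
move=> sC; exists #|block s None|; last by rewrite inE sC eqxx.
move: sC; rewrite finset.in_setD => /andP[_ /facesP[sb _]].
exact: leq_trans (leq_addr _ _) (sb ord0).
Qed.

Definition slice s o : {set 'I_r.+1} := [set a | (o, a) \in s]%SET.

Lemma card_slice s o : #|slice s o| = #|block s o|.
Proof.
rewrite -(card_imset (slice s o) (f := pair o)) => [|a b []//].
apply: eq_card => -[p a]; rewrite inE /=; apply/finset.imsetP/andP.
  by move=> [b]; rewrite inE => ob [-> ->].
by move=> [os /eqP po]; exists a; rewrite ?inE -?po.
Qed.

Lemma prod_option (F : option 'I_n.+1 -> nat) :
  \prod_o F o = F None * \prod_i F (Some i).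
Proof.
rewrite (bigD1 None) //=; congr (_ * _).
rewrite (reindex_onto Some (fun o => odflt ord0 o)) /=; last by case.
by apply: eq_bigl => i; rewrite eqxx.
Qed.

(** A vertex set is the same thing as a family of subsets of the cliques. *)
Lemma card_sliced (F : option 'I_n.+1 -> {set {set 'I_r.+1}}) :
  #|[set s : {set V} | [forall o, slice s o \in F o]]%SET| =
  #|F None| * \prod_i #|F (Some i)|.
Proof.
pose sl s : {ffun option 'I_n.+1 -> {set 'I_r.+1}} := [ffun o => slice s o].
pose as_ (f : {ffun option 'I_n.+1 -> {set 'I_r.+1}}) : {set V} :=
  [set v | v.2 \in f v.1]%SET.
have slK : cancel sl as_.
  by move=> s; apply/finset.setP => -[p a]; rewrite inE ffunE inE.
have asK : cancel as_ sl.
  by move=> f; apply/ffunP => o; apply/finset.setP => a; rewrite ffunE !inE.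
rewrite -(prod_option (fun o => #|F o|)) -(card_imset _ (can_inj slK)).
have -> : \prod_o #|F o| = #|family (fun o => mem (F o))|.
  by rewrite card_family foldrE big_map big_enum.
apply: eq_card => f; apply/finset.imsetP/familyP => [[s]|fF].
  by rewrite inE => /forallP sF -> o; rewrite ffunE.
exists (as_ f) => //; rewrite inE; apply/forallP => o.
by have := fF o; rewrite -{1}(asK f) ffunE.
Qed.
End CriticalCells.

(** * Counting the critical faces *)

Section CountCriticalCells.
Variables n r d : nat.
Local Notation V := (option 'I_n.+1 * 'I_r.+1)%type.
Implicit Types s t : {set V}.
Local Open Scope nat_scope.
Hypothesis d_gt0 : 0 < d.
Hypothesis d_le : d <= n.+1.

Local Notation faces := (@faces n r d).
Local Notation matched := (@matched n r d).
Local Notation critical_with_centre := (@critical_with_centre n r d).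
Local Notation zero_vertex := (@zero_vertex n r).
Local Notation pivot := (@pivot n r).
Local Notation toggle := (toggle_at pivot).

Lemma card_critical_with_centre0 :
  #|critical_with_centre 0| = 'C(r, 2) ^ n.+1.
Proof.
pose F (o : option 'I_n.+1) : {set {set 'I_r.+1}} :=
  if o is None then [set finset.set0]%SET
  else [set B : {set 'I_r.+1} | (B \subset [set~ ord0]%SET) && (#|B| == 2)]%SET.
rewrite (_ : critical_with_centre 0 =
    [set s : {set V} | [forall o, slice s o \in F o]]%SET).
  rewrite card_sliced /= cards1 mul1n prod_nat_const card_ord cards_draws.
  by rewrite cardsC1 card_ord.
apply/finset.setP => s; rewrite [RHS]inE; apply/idP/forallP => [sC|sF].
  have [sc /facesP[sb _] s0] := critical_with_centreP sC.
  move=> [i|] /=; last by rewrite inE -cards_eq0 card_slice s0.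
  have := critical_dark sc; rewrite s0 => /(_ isT i); rewrite add0n => dark.
  have bi := sb i; rewrite s0 add0n in bi.
  have zs : zero_vertex i \notin block s (Some i).
    by apply/negP => zs; move: bi; rewrite (cardsD1 (zero_vertex i)) zs add1n ltnNge dark.
  rewrite inE card_slice eqn_leq bi /= (leq_trans dark) ?andbT; last first.
    exact/subset_leq_card/finset.subD1set.
  apply/fintype.subsetP => a; rewrite !inE; apply: contraTneq => ->.
  by move: zs; rewrite inE eqxx andbT.
have s0 : #|block s None| = 0.
  by have := sF None; rewrite inE -cards_eq0 card_slice => /eqP.
have s2 i : #|block s (Some i)| = 2.
  by have := sF (Some i); rewrite inE card_slice => /andP[_ /eqP].
have sz i : block s (Some i) :\ zero_vertex i = block s (Some i).
  have := sF (Some i); rewrite inE => /andP[/fintype.subsetP z _].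
  apply/finset.setP => v; rewrite !inE; have [->|//] := eqVneq v (zero_vertex i).
  by apply/esym/negP => /andP[zs _]; have := z ord0; rewrite !inE eqxx => /(_ zs).
rewrite inE s0 eqxx andbT; apply: dark_critical => [|i]; last by rewrite sz s0 s2.
by rewrite inE s0 andbT; apply/forallP => i; rewrite s2.
Qed.

Lemma card_critical_with_centre2 : #|critical_with_centre 2| = 'C(r.+1, 2).
Proof.
pose F (o : option 'I_n.+1) : {set {set 'I_r.+1}} :=
  if o is None then [set B : {set 'I_r.+1} | #|B| == 2]%SET
  else [set finset.set0]%SET.
rewrite (_ : critical_with_centre 2 =
    [set s : {set V} | [forall o, slice s o \in F o]]%SET).
  rewrite card_sliced /= [X in _ * X]big1 ?muln1 => [|i _]; last by rewrite cards1.
  by rewrite card_draws card_ord.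
apply/finset.setP => s; rewrite [RHS]inE; apply/idP/forallP => [sC|sF].
  have [_ /facesP[sb _] s2] := critical_with_centreP sC.
  move=> [i|] /=; last by rewrite inE card_slice s2.
  rewrite inE -cards_eq0 card_slice.
  by have := sb i; rewrite s2 -leqn0 -{2}[2]addn0 leq_add2l.
have s2 : #|block s None| = 2.
  by have := sF None; rewrite inE card_slice => /eqP.
have s0 i : #|block s (Some i)| = 0.
  by have := sF (Some i); rewrite inE -cards_eq0 card_slice => /eqP.
rewrite inE s2 eqxx andbT; apply: dark_critical => [|i]; last by rewrite s2.
by rewrite inE s2 andbT; apply/forallP => i; rewrite s0.
Qed.

Definition centred : {set {set V}} := [set s in faces | #|block s None| == 1]%SET.

Lemma centredP s : s \in centred <->
  [/\ #|block s None| = 1, forall i, #|block s (Some i)| <= 1 & #|s| <= d.+1].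
Proof.
split=> [|[c1 sb sd]].
  rewrite inE => /andP[/facesP[sb sd] /eqP c1]; split=> [//|i|]; last exact: sd.
  by have := sb i; rewrite c1 add1n.
rewrite !inE c1 sd eqxx !andbT; apply/forallP => i; rewrite add1n ltnS; exact: sb.
Qed.

(** Choose the [i] leaf cliques that contain a vertex, these vertices, and the
    central vertex. *)
Lemma card_centred_of_size i : i <= d ->
  #|[set s in centred | #|s| == i.+1]%SET| = r.+1 * ('C(n.+1, i) * r.+1 ^ i).
Proof.
move=> id_; pose leaves s : {set 'I_n.+1} := [set j | #|block s (Some j)| == 1]%SET.
have leavesE s : s \in centred -> #|s| = (#|leaves s|).+1.
  move=> /centredP[c1 sb _]; rewrite card_blocks c1 add1n; congr _.+1.
  rewrite -sum1_card [RHS]big_mkcond; apply: eq_bigr => j _; rewrite inE.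
  by have := sb j; case: #|_| => [|[]].
rewrite -sum1_card (partition_big leaves
  (fun B => B \in [set B : {set 'I_n.+1} | #|B| == i]%SET)); last first.
  by move=> s /[!inE]/andP[sS /eqP]; rewrite -inE leavesE ?inE// => -[->].
rewrite (eq_bigr (fun=> r.+1 * r.+1 ^ i)) => [|B].
  by rewrite sum_nat_const card_draws card_ord mulnCA.
rewrite inE => /eqP Bi.
pose F (o : option 'I_n.+1) : {set {set 'I_r.+1}} :=
  if o is Some j then
    if j \in B then [set A : {set 'I_r.+1} | #|A| == 1]%SET else [set finset.set0]%SET
  else [set A : {set 'I_r.+1} | #|A| == 1]%SET.
have c1 : #|[set A : {set 'I_r.+1} | #|A| == 1]%SET| = r.+1.
  by rewrite card_draws card_ord bin1.
rewrite sum1_card (_ : #|_| = #|[set s : {set V} | [forall o, slice s o \in F o]]%SET|).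
  rewrite card_sliced /= c1; congr (_ * _).
  rewrite (bigID (mem B)) /= [X in _ * X]big1 ?muln1 => [|j /negPf ->];
    last exact: cards1.
  rewrite (eq_bigr (fun=> r.+1)) => [|j ->//].
  by rewrite prod_nat_const Bi.
apply: eq_card => s; rewrite [RHS]inE; apply/idP/forallP.
  move=> /andP[/setIdP[sS _] /eqP sB] [j|]; have /centredP[s1 sb _] := sS; last first.
    by rewrite inE card_slice s1.
  rewrite /= -sB inE; case: ifP => [jB|jB]; first by rewrite inE card_slice.
  rewrite inE -cards_eq0 card_slice; move: jB (sb j).
  by case: #|_| => [|[]].
move=> sF; have s1 : #|block s None| = 1.
  by have := sF None; rewrite inE card_slice => /eqP.
have sj j : #|block s (Some j)| = (j \in B).
  have := sF (Some j) => /=; case: ifP => _; rewrite inE ?card_slice => /eqP //.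
  by move/eqP; rewrite -cards_eq0 card_slice => /eqP.
have sB : leaves s = B by apply/finset.setP => j; rewrite inE sj; case: (_ \in _).
have si : #|s| = i.+1.
  rewrite card_blocks s1 add1n -Bi -sum1_card [in RHS]big_mkcond; congr _.+1.
  by apply: eq_bigr => j _; rewrite sj; case: (_ \in _).
rewrite /in_mem /= sB eqxx andbT; apply/setIdP; split; last by rewrite si.
by apply/centredP; split=> // [j|]; [rewrite sj leq_b1|rewrite si].
Qed.

Lemma sign_toggle s : ((-1) ^+ #|toggle s| = - (-1) ^+ #|s| :> int)%R.
Proof.
rewrite /toggle_at; case: ifPn => ps.
  by rewrite (cardsD1 (pivot s) s) ps add1n exprS mulN1r opprK.
by rewrite cardsU1 ps add1n exprS mulN1r.
Qed.

Lemma matched_centred_toggle s :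
  (toggle s \in centred) && (toggle s \in matched) =
  (s \in centred) && (s \in matched).
Proof.
have half t : (t \in centred) && (t \in matched) ->
    (toggle t \in centred) && (toggle t \in matched).
  move=> /andP[tS tM]; have tM' := toggle_matched tM; rewrite tM' andbT.
  move: tS tM'; rewrite !(finset.in_setI, inE) block_toggleE => /andP[_ ->].
  by rewrite !andbT => /andP[].
apply/idP/idP => [|/half//].
by move=> /half; rewrite toggleK.
Qed.

(** Toggling is a sign-reversing involution of the matched faces. *)
Lemma alternating_sum_centred :
  (\sum_(s in centred) (-1) ^+ #|s| =
   (-1) ^+ d.+1 * #|critical_with_centre 1%N|%:Z :> int)%R.
Proof.
rewrite (bigID (mem matched)) /= [X in (X + _)%R](_ : _ = 0)%R.
  rewrite add0r (eq_bigl (fun s => s \in critical_with_centre 1%N)).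
    rewrite (eq_bigr (fun=> (-1) ^+ d.+1)%R) => [|s sC].
      by rewrite sumr_const -mulr_natr natz.
    by rewrite (card_critical1 d_le sC).
  have cS s : (s \in centred) = (s \in faces) && (#|block s None| == 1) by rewrite inE.
  have cC s : (s \in critical_with_centre 1) =
      [&& s \notin matched, s \in faces & #|block s None| == 1].
    by rewrite inE finset.in_setD -andbA.
  by move=> s; rewrite cS cC; case: (s \in matched); rewrite /= ?andbF ?andbT.
set S := (X in X = _); have : S = (- S)%R; last by lia.
rewrite {1}/S (reindex_inj (inv_inj (@toggleK n r))) /= -sumrN.
by apply: eq_big => [s|s _]; [exact: matched_centred_toggle|exact: sign_toggle].
Qed.

Lemma card_critical_with_centre1 :
  (#|critical_with_centre 1%N|%:Z = r.+1%:Z * skeleton_rank d r.+1 n.+1)%R.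
Proof.
have := alternating_sum_centred.
rewrite (partition_big (fun s => inord #|s|.-1 : 'I_d.+1) xpredT) //=.
rewrite (eq_bigr (fun i : 'I_d.+1 => (-1) ^+ d.+1 *
    (r.+1%:Z * ((-1) ^+ (d - i) * ('C(n.+1, i) * r.+1 ^ i)%N%:Z)))%R) => [|i _].
  rewrite -!mulr_sumr -/(skeleton_rank d r.+1 n.+1) => /esym.
  by apply: mulfI; rewrite expf_neq0.
have id_ : i <= d by rewrite -ltnS.
rewrite (eq_bigl (fun s => s \in [set s in centred | #|s| == i.+1]%SET)).
  rewrite (eq_bigr (fun=> (-1) ^+ i.+1)%R) => [|s /setIdP[_ /eqP ->//]].
  have sign : ((-1) ^+ i.+1 = (-1) ^+ d.+1 * (-1) ^+ (d - i) :> int)%R.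
    rewrite -exprD -[LHS]signr_odd -[RHS]signr_odd oddD oddB//=.
    by case: (odd d); case: (odd i).
  rewrite sumr_const card_centred_of_size// -mulr_natr natz PoszM sign.
  by rewrite -!mulrA; congr (_ * _)%R; rewrite mulrCA.
move=> s; rewrite [RHS]inE; apply: andb_id2l => /centredP[c1 _ sd].
have s0 : 0 < #|s| by rewrite card_blocks c1.
by rewrite -val_eqE /= inordK ?prednK// -[in RHS](prednK s0) eqSS.
Qed.
End CountCriticalCells.

(** * Sorting the spheres into wedges *)

Section CellEnumerations.
Variable V : finType.
Local Open Scope nat_scope.

Definition enumerates (A : {set {set V}}) (I : Type) (dim : I -> nat)
    (cell : I -> {set V}) : Prop :=
  [/\ injective cell, forall s, s \in A <-> exists i, s = cell i &
      forall i, #|cell i| = (dim i).+1].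

Lemma enumerate_set (A : {set {set V}}) k : (forall s, s \in A -> #|s| = k.+1) ->
  exists cell : 'I_#|A| -> {set V}, enumerates A (fun=> k) cell.
Proof.
move=> Ak; exists enum_val; split=> [|s|i]; first exact: enum_val_inj.
  split=> [sA|[i ->]]; last exact: enum_valP.
  by exists (enum_rank_in sA s); rewrite enum_rankK_in.
exact/Ak/enum_valP.
Qed.

Lemma enumerates_sum (A B : {set {set V}}) (I J : Type) (dI : I -> nat)
    (dJ : J -> nat) cI cJ :
  (forall s, s \in A -> s \notin B) -> enumerates A dI cI -> enumerates B dJ cJ ->
  enumerates (A :|: B)
    (fun a : I + J => match a with inl i => dI i | inr i => dJ i end)
    (fun a : I + J => match a with inl i => cI i | inr i => cJ i end).
Proof.
move=> AB [cII cIA cId] [cJI cJB cJd]; split.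
- have IJ i j : cI i <> cJ j.
    move=> ij; have : cI i \in A by apply/cIA; exists i.
    by move=> /AB/negP; apply; apply/cJB; exists j.
  move=> [i|i] [j|j] //.
  + by move=> /cII ->.
  + by move/IJ.
  + by move/esym/IJ.
  + by move=> /cJI ->.
- move=> s; rewrite inE; split=> [/orP[/cIA[i ->]|/cJB[i ->]]|[[i|i] ->]].
  + by exists (inl i).
  + by exists (inr i).
  + by apply/orP; left; apply/cIA; exists i.
  + by apply/orP; right; apply/cJB; exists i.
- by move=> [i|i].
Qed.
End CellEnumerations.

Section WedgeDecomposition.
Variables (R : realType) (n r d : nat).
Local Notation V := (option 'I_n.+1 * 'I_r.+1)%type.
Local Open Scope nat_scope.
Hypothesis d_gt0 : 0 < d.
Hypothesis d_le : d <= n.+1.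
Variable K : scomplex V.
Hypothesis K_faces : forall s, simplices K s <-> s \in faces n r d.

Local Notation crit := (@critical_with_centre n r d).

Lemma critical_partition : critical n r d = (crit 0 :|: crit 1 :|: crit 2)%SET.
Proof.
apply/finset.setP => s; rewrite !finset.in_setU; apply/idP/idP => [/critical_centres|].
  by move=> [[|[|[|//]]] _ ->]; rewrite ?orbT.
by move=> /orP[/orP[]|] /critical_with_centreP[].
Qed.

Lemma crit_disjoint k k' s : k != k' -> s \in crit k -> s \notin crit k'.
Proof.
move=> kk' /critical_with_centreP[_ _ sk]; apply: contra kk'.
by move=> /critical_with_centreP[_ _ sk']; rewrite -sk sk'.
Qed.

Lemma wedge_of_three :
  homotopy_equivalent R (realization R K)
    (wedge2 (wedge2 (wedge_spheres R #|crit 0| (2 * n.+1 - 1))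
                    (wedge_spheres R #|crit 1| d))
            (wedge_spheres R #|crit 2| 1)).
Proof.
have [|c0 e0] := @enumerate_set _ (crit 0) (2 * n.+1 - 1).
  by move=> s /card_critical0 ->; lia.
have [|c1 e1] := @enumerate_set _ (crit 1) d.
  by move=> s /(card_critical1 d_le).
have [|c2 e2] := @enumerate_set _ (crit 2) 1.
  by move=> s /card_critical2.
have e01 := enumerates_sum (fun s => @crit_disjoint 0 1 s isT) e0 e1.
have [|cI cP cd] := enumerates_sum _ e01 e2.
  by move=> s /finset.setUP[]; exact: crit_disjoint.
apply: (faces_homotopy_equivalent d_gt0 K_faces _ _ cI _ cd).
- do 2?apply: wedge2_hausdorff; exact: wedge_spheres_hausdorff.
- by do 2?apply: wedge2_bouquet; exact: wedge_spheres_bouquet.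
- by rewrite critical_partition.
Qed.

(** For [d = 1] the critical faces with one central vertex are edges, like those
    with two, and share a wedge of circles with them. *)
Lemma wedge_of_two : d = 1 ->
  homotopy_equivalent R (realization R K)
    (wedge2 (wedge_spheres R #|crit 0| (2 * n.+1 - 1))
            (wedge_spheres R (#|crit 1| + #|crit 2|) 1)).
Proof.
move=> d1; have [|c0 e0] := @enumerate_set _ (crit 0) (2 * n.+1 - 1).
  by move=> s /card_critical0 ->; lia.
have [|c1 e1] := @enumerate_set _ (crit 1 :|: crit 2)%SET 1.
  move=> s /finset.setUP[/(card_critical1 d_le) ->|/card_critical2//].
  by rewrite d1.
have [|cI cP cd] := enumerates_sum _ e0 e1.
  by move=> s s0; rewrite finset.in_setU negb_or !(crit_disjoint _ s0).
have -> : #|crit 1| + #|crit 2| = #|(crit 1 :|: crit 2)%SET|.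
  rewrite finset.cardsU (_ : _ :&: _ = finset.set0)%SET ?cards0 ?subn0//.
  apply/finset.setP => s; rewrite finset.in_setI finset.in_set0.
  by apply/negP => /andP[/(@crit_disjoint 1 2 s isT)/negP].
apply: (faces_homotopy_equivalent d_gt0 K_faces _ _ cI _ cd).
- apply: wedge2_hausdorff; exact: wedge_spheres_hausdorff.
- by apply: wedge2_bouquet; exact: wedge_spheres_bouquet.
- by rewrite critical_partition -finset.setUA.
Qed.
End WedgeDecomposition.

Theorem proposition33 (R : realType) (r n : nat) (hr : (0 < r)%N)
    (hn : (0 < n)%N) :
  [/\ homotopy_equivalent R
        (realization R
           (bounded_forest_complex 1 (lex_product (star n) (complete r))))
        (wedge2 (wedge_spheres R ('C(r - 1, 2) ^ n)%N (2 * n - 1)%N)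
                (wedge_spheres R ((n * r ^ 2 - 1) + 'C(r - 1, 2))%N 1)),
      forall d : nat, (2 <= d <= n - 1)%N ->
      homotopy_equivalent R
        (realization R
           (bounded_forest_complex d (lex_product (star n) (complete r))))
        (wedge2 (wedge2
           (wedge_spheres R ('C(r - 1, 2) ^ n)%N (2 * n - 1)%N)
           (wedge_spheres R (r * absz (skeleton_rank d r n))%N d))
           (wedge_spheres R 'C(r, 2) 1))
    & homotopy_equivalent R
        (realization R (forest_complex (lex_product (star n) (complete r))))
        (wedge2 (wedge2
           (wedge_spheres R ('C(r - 1, 2) ^ n)%N (2 * n - 1)%N)
           (wedge_spheres R (r * (r - 1) ^ n)%N n))
           (wedge_spheres R 'C(r, 2) 1))].
Proof.
case: r hr => // r _; case: n hn => // n _; rewrite (subn1 r.+1) /=.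
pose G := lex_product (star n.+1) (complete r.+1).
have crit1 d : (0 < d)%N -> (d <= n.+1)%N ->
    (r.+1 * absz (skeleton_rank d r.+1 n.+1) = #|critical_with_centre n r d 1|)%N.
  move=> d0 dn; have /(congr1 absz) := @card_critical_with_centre1 n r d d0 dn.
  by rewrite abszM => <-.
split.
- have := @wedge_of_two R n r 1 isT isT (bounded_forest_complex 1 G)
    (fun s => @bounded_forest_faces n r 1 s isT) erefl.
  rewrite card_critical_with_centre0 card_critical_with_centre2 -crit1//.
  have -> // : (r.+1 * absz (skeleton_rank 1 r.+1 n.+1) + 'C(r.+1, 2) =
            n.+1 * r.+1 ^ 2 - 1 + 'C(r, 2))%N.
  have sk : skeleton_rank 1 r.+1 n.+1 = (n.+1 * r.+1)%N%:Z - 1.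
    rewrite /skeleton_rank big_ord_recr big_ord1 /= bin0 bin1 expn1.
    by rewrite subn0 subnn expr0 expr1 mul1r mulN1r expn0 muln1 addrC.
  rewrite sk binS bin1.
  have -> : absz ((n.+1 * r.+1)%N%:Z - 1) = (n.+1 * r.+1 - 1)%N by lia.
  by rewrite expnS expn1; nia.
- move=> d /andP[d2 dn]; have d0 : (0 < d)%N by lia.
  have dn1 : (d <= n.+1)%N by lia.
  have := @wedge_of_three R n r d d0 dn1 (bounded_forest_complex d G)
    (fun s => bounded_forest_faces s d0).
  by rewrite card_critical_with_centre0 card_critical_with_centre2 -crit1.
have := @wedge_of_three R n r n.+1 isT (leqnn _) (forest_complex G)
  (@forest_faces n r).
rewrite card_critical_with_centre0 card_critical_with_centre2 -crit1//.
rewrite skeleton_rank_diag abszX.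
by have -> : absz (r.+1%:Z - 1) = r by lia.
Qed.
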